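(* Let $G$ be a connected group of finite Morley rank in which, generically, elements belong to connected nilpotent subgroups. Then for every definable subgroup $H$ of $G$ and every element $w\in N(H)\setminus H$ (that is, $w$ normalizes $H$ but is not in $H$), the coset $wH$ is not generous in $G$.
   Context: Groups of finite Morley rank are equipped with the rank $\mathrm{rk}$ on definable sets (Borovik–Poizat axioms); ''definable'' means definable by a first-order formula, possibly with parameters and possibly in quotients by definable equivalence relations. The definable hull of a subset of $G$ is the smallest definable subgroup containing it. $G^\circ$ is the smallest definable subgroup of finite index of $G$; a definable group is connected if it equals its connected component, and an arbitrary subgroup is called connected if its definable hull is connected. A definable subset of a definable set $A$ is generic in $A$ if it has rank $\mathrm{rk}(A)$. A definable subset $X$ of $G$ is generous in $G$ if $X^G=\bigcup_{g\in G}X^g$ is generic in $G$, where $X^g=g^{-1}Xg$. $N(H)=\{g\in G : H^g=H\}$. ''Generically, elements of $G$ belong to connected nilpotent subgroups'' means one of the following: either $G$ is saturated and the realizations in $G$ of the generic type (over some small set of parameters) each belong to a connected nilpotent subgroup of $G$; or (with no saturation assumption) $G$ has a definable generic subset, each of whose elements belongs to a connected nilpotent subgroup of $G$. *)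

(* Defs.v *)
From mathcomp Require Import all_boot.
From mathcomp Require Import boolp classical_sets functions cardinality.

Set Implicit Arguments.
Unset Strict Implicit.
Unset Printing Implicit Defensive.

Local Open Scope classical_set_scope.
Local Open Scope card_scope.
Local Open Scope group_scope.

(* The group language is built into terms and formulas; a signature lists the
   further symbols.  It is relational: a function or a constant is given by its
   graph, which changes neither the sets definable over a given set of
   parameters nor saturation. *)
Record signature := Signature { symbol : Type; arity : symbol -> nat }.

Section Formulas.
Variables (L : signature) (G : groupType).

Inductive term (n : nat) : Type :=
| Var of 'I_n
| Param of G
| One
| Inv of term n
| Mul of term n & term n.

(* [Ex] binds variable 0 of its body. *)
Inductive formula : nat -> Type :=
| Eq n of term n & term n : formula n
| Rel n (r : symbol L) of (arity r).-tuple (term n) : formula n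
| Not n of formula n : formula n
| And n of formula n & formula n : formula n
| Ex n of formula n.+1 : formula n.

Definition structure := forall r : symbol L, set ((arity r).-tuple G).

Variable M : structure.

Fixpoint eval n (v : n.-tuple G) (t : term n) : G :=
  match t with
  | Var i => tnth v i
  | Param g => g
  | One => 1
  | Inv t1 => (eval v t1)^-1
  | Mul t1 t2 => eval v t1 * eval v t2
  end.

Fixpoint sat n (phi : formula n) : n.-tuple G -> Prop :=
  match phi in formula n return n.-tuple G -> Prop with
  | Eq _ t1 t2 => fun v => eval v t1 = eval v t2
  | Rel _ r ts => fun v => M (map_tuple (eval v) ts)
  | Not _ phi1 => fun v => ~ sat phi1 v
  | And _ phi1 phi2 => fun v => sat phi1 v /\ sat phi2 v
  | Ex _ phi1 => fun v => exists g : G, sat phi1 [tuple of g :: v]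
  end.

Fixpoint term_over (A : set G) n (t : term n) : Prop :=
  match t with
  | Param g => A g
  | Inv t1 => term_over A t1
  | Mul t1 t2 => term_over A t1 /\ term_over A t2
  | _ => True
  end.

Fixpoint formula_over (A : set G) n (phi : formula n) : Prop :=
  match phi with
  | Eq _ t1 t2 => term_over A t1 /\ term_over A t2
  | Rel _ _ ts => forall i, term_over A (tnth ts i)
  | Not _ phi1 => formula_over A phi1
  | And _ phi1 phi2 => formula_over A phi1 /\ formula_over A phi2
  | Ex _ phi1 => formula_over A phi1
  end.

Definition definable_tuples n (X : set (n.-tuple G)) : Prop :=
  exists phi : formula n, X = [set v | sat phi v].

Definition solutions (phi : formula 1) : set G := [set g | sat phi [tuple g]].

Definition definable (X : set G) : Prop :=
  exists phi : formula 1, X = solutions phi.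

(* An interpretable set X / E, where X is a definable set of n-tuples and E a
   definable equivalence relation on X, is the set of its E-classes, hence a
   set of sets of n-tuples. *)
Definition quotient_set n (X : set (n.-tuple G))
    (E : n.-tuple G -> n.-tuple G -> Prop) : set (set (n.-tuple G)) :=
  [set [set y | X y /\ E x y] | x in X].

Definition equivalence_on n (X : set (n.-tuple G))
    (E : n.-tuple G -> n.-tuple G -> Prop) : Prop :=
  [/\ forall x, X x -> E x x,
      forall x y, X x -> X y -> E x y -> E y x
    & forall x y z, X x -> X y -> X z -> E x y -> E y z -> E x z].

Definition definable_rel n (X : set (n.-tuple G))
    (E : n.-tuple G -> n.-tuple G -> Prop) : Prop :=
  definable_tuples
    [set z | exists x y, [/\ X x, X y, E x y & z = [tuple of x ++ y]]].

Definition interpretable n (S : set (set (n.-tuple G))) : Prop :=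
  exists (X : set (n.-tuple G)) (E : n.-tuple G -> n.-tuple G -> Prop),
    [/\ definable_tuples X, definable_rel X E, equivalence_on X E
      & S = quotient_set X E].

(* The pair formed by a class of m-tuples and a class of n-tuples, coded as a
   class of (m + n)-tuples. *)
Definition class_pair m n (C : set (m.-tuple G)) (D : set (n.-tuple G)) :
    set ((m + n).-tuple G) :=
  [set z | exists x y, [/\ C x, D y & z = [tuple of x ++ y]]].

Definition definable_fun m n (S : set (set (m.-tuple G)))
    (T : set (set (n.-tuple G))) (f : set (m.-tuple G) -> set (n.-tuple G)) :
    Prop :=
  (forall C, S C -> T (f C)) /\ interpretable [set class_pair C (f C) | C in S].

Definition fibre m n (S : set (set (m.-tuple G)))
    (f : set (m.-tuple G) -> set (n.-tuple G)) (D : set (n.-tuple G)) :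
    set (set (m.-tuple G)) :=
  [set C | S C /\ f C = D].

(* Only the values on nonempty interpretable sets are meaningful. *)
Definition rank_function := forall n, set (set (n.-tuple G)) -> nat.

(* The Borovik-Poizat axioms. *)
Record ranked (rk : rank_function) : Prop := Ranked {
  ranked_monotone : forall n (S : set (set (n.-tuple G))) (k : nat),
    interpretable S -> S !=set0 ->
    (k < rk n S)%N <->
    exists F : nat -> set (set (n.-tuple G)),
      [/\ forall i, interpretable (F i) /\ F i `<=` S,
          forall i, F i !=set0,
          trivIset [set: nat] F
        & forall i, (k <= rk n (F i))%N];
  ranked_definable : forall m n (S : set (set (m.-tuple G)))
    (T : set (set (n.-tuple G))) f (k : nat),
    interpretable S -> interpretable T -> definable_fun S T f ->
    interpretable
      [set D | [/\ T D, fibre S f D !=set0 & rk m (fibre S f D) = k]];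
  ranked_additive : forall m n (S : set (set (m.-tuple G)))
    (T : set (set (n.-tuple G))) f (k : nat),
    interpretable S -> interpretable T -> S !=set0 -> definable_fun S T f ->
    (forall D, T D ->
      fibre S f D !=set0 /\ rk m (fibre S f D) = k) ->
    rk m S = (rk n T + k)%N;
  ranked_finite_bounds : forall m n (S : set (set (m.-tuple G)))
    (T : set (set (n.-tuple G))) f,
    interpretable S -> interpretable T -> definable_fun S T f ->
    exists b : nat, forall D, T D ->
      infinite_set (fibre S f D) \/ fibre S f D #<= `I_b
}.

Definition points (X : set G) : set (set (1.-tuple G)) :=
  [set [set [tuple x]] | x in X].

Definition generic (rk : rank_function) (A X : set G) : Prop :=
  [/\ X `<=` A, X !=set0 & rk 1%N (points X) = rk 1%N (points A)].

Definition conj_set (X : set G) (g : G) : set G := [set x ^ g | x in X].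

Definition generous (rk : rank_function) (X : set G) : Prop :=
  generic rk [set: G] (\bigcup_(g in [set: G]) conj_set X g).

Definition normalizer (H : set G) : set G := [set g | conj_set H g = H].

Definition left_coset (g : G) (H : set G) : set G := [set g * h | h in H].

Definition subgroup (H : set G) : Prop :=
  [/\ H 1, forall x y, H x -> H y -> H (x * y) & forall x, H x -> H x^-1].

Definition definable_subgroup (H : set G) : Prop := subgroup H /\ definable H.

Definition finite_index (H K : set G) : Prop :=
  K `<=` H /\ finite_set [set left_coset h K | h in H].

Definition is_connected_component (H K : set G) : Prop :=
  [/\ definable_subgroup K, finite_index H K
    & forall K', definable_subgroup K' -> finite_index H K' -> K `<=` K'].

Definition connected_definable (H : set G) : Prop :=
  definable_subgroup H /\ is_connected_component H H.

Definition is_definable_hull (X K : set G) : Prop :=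
  [/\ definable_subgroup K, X `<=` K
    & forall K', definable_subgroup K' -> X `<=` K' -> K `<=` K'].

Definition connected_subgroup (H : set G) : Prop :=
  subgroup H /\ exists K, is_definable_hull H K /\ connected_definable K.

Definition generated (X : set G) : set G :=
  \bigcap_(K in [set K | subgroup K /\ X `<=` K]) K.

Fixpoint lower_central (H : set G) (n : nat) : set G :=
  if n is n'.+1 then
    generated [set z | exists x y,
      [/\ lower_central H n' x, H y & z = [~ x, y]]]
  else H.

Definition nilpotent (H : set G) : Prop :=
  exists n, lower_central H n = [set 1].

Definition in_connected_nilpotent (g : G) : Prop :=
  exists N : set G, [/\ connected_subgroup N, nilpotent N & N g].

Definition small (A : set G) : Prop :=
  A #<= [set: G] /\ ~ ([set: G] #<= A).

Definition realizes n (p : set (formula n)) (v : n.-tuple G) : Prop :=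
  forall phi, p phi -> sat phi v.

Definition finitely_satisfiable n (p : set (formula n)) : Prop :=
  forall q : set (formula n), finite_set q -> q `<=` p -> exists v, realizes q v.

Definition complete_type (A : set G) n (p : set (formula n)) : Prop :=
  [/\ forall phi, p phi -> formula_over A phi,
      finitely_satisfiable p
    & forall phi, formula_over A phi -> p phi \/ p (Not phi)].

Definition saturated : Prop :=
  forall (A : set G) n (p : set (formula n)),
    small A -> complete_type A p -> exists v, realizes p v.

(* For connected G this is a complete type, as the complement of a generic
   definable set is then not generic. *)
Definition generic_type (rk : rank_function) (A : set G) : set (formula 1) :=
  [set phi | formula_over A phi /\ generic rk [set: G] (solutions phi)].

Definition generically_connected_nilpotent (rk : rank_function) : Prop :=
  (saturated /\
    exists A : set G, small A /\
      forall g : G, realizes (generic_type rk A) [tuple g] ->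
        in_connected_nilpotent g)
  \/
  (exists X : set G, [/\ definable X, generic rk [set: G] X
    & forall g, X g -> in_connected_nilpotent g]).

End Formulas.

(* Main.v *)
(* Write [C = wH] and suppose that [C] is generous. Counting ranks in the set of
   pairs [(g, x)] with [x] in [C^g], a generic [x] of [G] lies in some [C^g], and
   the [g] with [x] in [C^g] form finitely many cosets [Hg]. As [G] is connected,
   two generic definable sets meet, so such an [x] can be taken in a connected
   nilpotent subgroup [N]; conjugating, assume that [x] is in [C], so [C = xH].

   Going up the lower central series of [N] from the trivial term, each term is
   covered by finitely many cosets of a definable subgroup [D] of [H] normalized
   by [N]. Indeed, if this holds for the term [k + 1], then the elements [z] of
   the term [k] move the coset [xD] in finitely many ways, as [[~ x, z]] is in the
   term [k + 1], and those with [x^z] in [xD], hence in [xH], lie in finitely many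
   cosets of [H]; by the descending chain condition, the intersection of the
   conjugates of [H] under [N] can then serve as the new [D]. For [N] itself this
   makes [ND] a definable subgroup in which [D] has finite index, so connectedness
   puts [N], hence [x], inside [H], which is impossible. *)

Require Import Defs.
From mathcomp Require Import all_boot.
From mathcomp Require Import boolp classical_sets functions cardinality.

Set Implicit Arguments.
Unset Strict Implicit.
Unset Printing Implicit Defensive.

Local Open Scope classical_set_scope.
Local Open Scope card_scope.
Local Open Scope group_scope.

(** * Definable sets *)

Section Definability.
Variables (L : signature) (G : groupType) (M : structure L G).

Fixpoint subst_term m n (t : 'I_m -> term G n) (s : term G m) : term G n :=
  match s with
  | Var i => t i
  | Param g => Param n g
  | One => One G n
  | Defs.Inv s1 => Defs.Inv (subst_term t s1)
  | Mul s1 s2 => Mul (subst_term t s1) (subst_term t s2)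
  end.

(** Every map to which the rank axioms are applied below has this form. *)
Definition eval_tuple m n (t : 'I_m -> term G n) (v : n.-tuple G) :
  m.-tuple G := [tuple eval v (t i) | i < m].

Lemma eval_subst m n (t : 'I_m -> term G n) s v :
  eval v (subst_term t s) = eval (eval_tuple t v) s.
Proof.
elim: s => [i|g||s IH|s1 IH1 s2 IH2] //=; first by rewrite tnth_mktuple.
- by rewrite IH.
- by rewrite IH1 IH2.
Qed.

(** As [Ex] binds variable 0, a substitution passing under it fixes that variable and shifts the
    variables of the terms of [t]. *)
Definition lift_subst m n (t : 'I_m -> term G n) (i : 'I_m.+1) : term G n.+1 :=
  if unlift ord0 i is Some j then
    subst_term (fun k => Var G (lift ord0 k)) (t j)
  else Var G ord0.

Lemma eval_weaken n (s : term G n) g (v : n.-tuple G) :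
  eval [tuple of g :: v] (subst_term (fun k => Var G (lift ord0 k)) s)
  = eval v s.
Proof.
rewrite eval_subst; congr eval; apply: eq_from_tnth => i.
by rewrite tnth_mktuple /= tnthS.
Qed.

Lemma eval_lift_subst m n (t : 'I_m -> term G n) g (v : n.-tuple G) :
  eval_tuple (lift_subst t) [tuple of g :: v] =
  [tuple of g :: eval_tuple t v].
Proof.
apply: eq_from_tnth => i; rewrite tnth_mktuple /lift_subst.
case: unliftP => [j ->|->] /=; last by rewrite !tnth0.
by rewrite eval_weaken tnthS tnth_mktuple.
Qed.

(** Induction on the formula. Some formula for the preimage is enough, so substitution need not be
    defined on formulas; under [Ex] the induction hypothesis is used for the lifted substitution. *)
Lemma definable_tuples_preimage m n (t : 'I_m -> term G n) X :
  definable_tuples M X -> definable_tuples M (eval_tuple t @^-1` X).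
Proof.
case=> phi ->; elim: phi n t => {X m}
  [m s1 s2|m r ts|m phi IH|m phi1 IH1 phi2 IH2|m phi IH] n t.
- exists (Eq L (subst_term t s1) (subst_term t s2)).
  by apply/seteqP; split=> v /=; rewrite !eval_subst.
- exists (Rel (map_tuple (subst_term t) ts)).
  have E (v : n.-tuple G) : map_tuple (eval v) (map_tuple (subst_term t) ts) =
      map_tuple (eval (eval_tuple t v)) ts.
    by apply: eq_from_tnth => i; rewrite !tnth_map eval_subst.
  by apply/seteqP; split=> v /=; rewrite E.
- have [psi E] := IH n t; exists (Not psi).
  by rewrite -[RHS]/(~` [set v | sat M psi v]) -E.
- have [psi1 E1] := IH1 n t; have [psi2 E2] := IH2 n t; exists (And psi1 psi2).
  rewrite -[RHS]/([set v | sat M psi1 v] `&` [set v | sat M psi2 v]).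
  by rewrite -E1 -E2.
- have [psi E] := IH n.+1 (lift_subst t); exists (Ex psi).
  have E' v : sat M phi (eval_tuple (lift_subst t) v) <-> sat M psi v.
    by move/seteqP: E => [E1 E2]; split=> [/E1|/E2].
  apply/seteqP; split=> v /= [g] Xg; exists g.
    by apply/E'; rewrite eval_lift_subst.
  by move: Xg => /E'; rewrite eval_lift_subst.
Qed.

Lemma definable_tuplesC n (X : set (n.-tuple G)) :
  definable_tuples M X -> definable_tuples M (~` X).
Proof. by case=> phi ->; exists (Not phi). Qed.

Lemma definable_tuplesI n (X Y : set (n.-tuple G)) :
  definable_tuples M X -> definable_tuples M Y -> definable_tuples M (X `&` Y).
Proof. by case=> phi -> [psi ->]; exists (And phi psi). Qed.

Lemma definable_tuplesU n (X Y : set (n.-tuple G)) :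
  definable_tuples M X -> definable_tuples M Y -> definable_tuples M (X `|` Y).
Proof.
move=> dX dY; rewrite -[X `|` Y]setCK setCU.
by apply/definable_tuplesC/definable_tuplesI; apply: definable_tuplesC.
Qed.

Lemma definable_tuples_eq n (s t : term G n) :
  definable_tuples M [set v | eval v s = eval v t].
Proof. by exists (Eq L s t). Qed.

Lemma definable_tuplesT n : definable_tuples M [set: n.-tuple G].
Proof. by exists (Eq L (One G n) (One G n)); apply/seteqP; split. Qed.

Lemma definable_tuples_forall n (I : eqType) (s : seq I)
    (P : I -> set (n.-tuple G)) :
  (forall i, definable_tuples M (P i)) ->
  definable_tuples M [set v | forall i, i \in s -> P i v].
Proof.
move=> dP; elim: s => [|i s IH].
  by rewrite (_ : mkset _ = setT); [exact: definable_tuplesT|apply/seteqP].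
rewrite (_ : mkset _ = P i `&` [set v | forall i, i \in s -> P i v]).
  exact: definable_tuplesI.
apply/seteqP; split=> v /=.
  by move=> H; split=> [|j js]; apply: H; rewrite inE ?eqxx// js orbT.
by case=> H1 H2 j; rewrite inE => /orP[/eqP->|/H2].
Qed.

Lemma definable_tuples_exists n (I : eqType) (s : seq I)
    (P : I -> set (n.-tuple G)) :
  (forall i, definable_tuples M (P i)) ->
  definable_tuples M [set v | exists2 i, i \in s & P i v].
Proof.
move=> dP; rewrite (_ : mkset _ =
  ~` [set v | forall i, i \in s -> (~` P i) v]).
  by apply/definable_tuplesC/definable_tuples_forall => i;
    apply: definable_tuplesC.
apply/seteqP; split=> v /=; first by case=> i si Pi /(_ i si).
by move=> /existsNP[i /not_implyP[si /contrapT]]; exists i.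
Qed.

Lemma definable_tuples_ex n (X : set (n.+1.-tuple G)) :
  definable_tuples M X ->
  definable_tuples M [set v : n.-tuple G | exists g, X [tuple of g :: v]].
Proof. by case=> phi ->; exists (Ex phi). Qed.

Lemma tuple1E (v : 1.-tuple G) : v = [tuple thead v].
Proof. by apply: eq_from_tnth => i; rewrite ord1 !tnth0. Qed.

Lemma definable1E (X : set G) :
  definable M X <-> definable_tuples M [set v : 1.-tuple G | X (thead v)].
Proof.
split=> -[phi E]; exists phi.
  rewrite E; apply/seteqP; split=> v /=; first by rewrite {2}[v]tuple1E.
  by rewrite {1}[v]tuple1E.
apply/seteqP; split=> g /=; move/seteqP: E => [E1 E2].
  exact: (E1 [tuple g]).
exact: (E2 [tuple g]).
Qed.

Lemma definable_term n (X : set G) (t : term G n) :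
  definable M X -> definable_tuples M [set v | X (eval v t)].
Proof.
move=> /definable1E /(definable_tuples_preimage (fun=> t)).
congr definable_tuples; apply/seteqP; split=> v /=;
  by rewrite /thead tnth_mktuple.
Qed.

Lemma definable_preimage (X : set G) (t : term G 1) :
  definable M X -> definable M [set x | X (eval [tuple x] t)].
Proof.
move=> /(definable_term t) dX; apply/definable1E; move: dX.
by congr definable_tuples; apply/seteqP; split=> v /=; rewrite -tuple1E.
Qed.

Lemma definable_forall (I : eqType) (s : seq I) (P : I -> set G) :
  (forall i, definable M (P i)) ->
  definable M [set x | forall i, i \in s -> P i x].
Proof.
move=> dP; apply/definable1E; apply: (definable_tuples_forall s
  (P := fun i => [set v : 1.-tuple G | P i (thead v)])) => i.
exact/definable1E.
Qed.

Lemma definable_exists (I : eqType) (s : seq I) (P : I -> set G) :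
  (forall i, definable M (P i)) ->
  definable M [set x | exists2 i, i \in s & P i x].
Proof.
move=> dP; apply/definable1E; apply: (definable_tuples_exists s
  (P := fun i => [set v : 1.-tuple G | P i (thead v)])) => i.
exact/definable1E.
Qed.

Lemma definableI (X Y : set G) :
  definable M X -> definable M Y -> definable M (X `&` Y).
Proof. by move=> /definable1E dX /definable1E dY; apply/definable1E/definable_tuplesI. Qed.

Lemma definableC (X : set G) : definable M X -> definable M (~` X).
Proof. by move=> /definable1E dX; apply/definable1E/definable_tuplesC. Qed.

Lemma definableD (X Y : set G) :
  definable M X -> definable M Y -> definable M (X `\` Y).
Proof. by move=> dX dY; apply/definableI/definableC. Qed.

Lemma definableT : definable M [set: G].
Proof. by apply/definable1E; apply: definable_tuplesT. Qed.

Lemma definable_set1 (g : G) : definable M [set g].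
Proof.
by exists (Eq L (Var G ord0) (Param 1 g)); apply/seteqP; split.
Qed.

Lemma definable_mull (X : set G) (g : G) :
  definable M X -> definable M [set x | X (g * x)].
Proof. exact: (definable_preimage (Mul (Param 1 g) (Var G ord0))). Qed.

Lemma definable_conj (X : set G) (g : G) :
  definable M X -> definable M [set x | X (x ^ g)].
Proof.
exact: (definable_preimage (Mul (Defs.Inv (Param 1 g))
  (Mul (Var G ord0) (Param 1 g)))).
Qed.

(** * Interpretability of definable sets *)

(** The quotient of [X] by equality: this is how a definable set enters the rank axioms, which speak
    of interpretable sets. *)
Definition singletons n (X : set (n.-tuple G)) : set (set (n.-tuple G)) :=
  [set [set v] | v in X].

Lemma definable_graph m n (t : 'I_n -> term G m) X :
  definable_tuples M X ->
  definable_tuples M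
    [set z | exists2 v : m.-tuple G, X v & z = cat_tuple v (eval_tuple t v)].
Proof.
move=> dX; pose p (i : 'I_m) := Var G (lshift n i).
have ep (v : m.-tuple G) (u : n.-tuple G) : eval_tuple p [tuple of v ++ u] = v.
  by apply: eq_from_tnth => i; rewrite tnth_mktuple /= tnth_lshift.
rewrite (_ : mkset _ = (eval_tuple p @^-1` X) `&`
  [set z | forall i, i \in enum 'I_n ->
    eval z (Var G (rshift m i)) = eval z (subst_term p (t i))]).
  apply: definable_tuplesI; first exact: definable_tuples_preimage.
  by apply: definable_tuples_forall => i; apply: definable_tuples_eq.
apply/seteqP; split=> z /=.
  case=> v Xv ->; rewrite ep; split=> // i _.
  by rewrite tnth_rshift eval_subst ep tnth_mktuple.
case=> Xz Ez; exists (eval_tuple p z) => //.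
apply: eq_from_tnth => i; rewrite -(fintype.splitK i); case: (fintype.split i) => j /=.
  by rewrite tnth_lshift tnth_mktuple.
by rewrite tnth_rshift tnth_mktuple Ez ?mem_enum// eval_subst.
Qed.

Lemma eval_tuple_var n (v : n.-tuple G) : eval_tuple (@Var G n) v = v.
Proof. by apply: eq_from_tnth => i; rewrite tnth_mktuple. Qed.

Lemma interpretable_singletons n (X : set (n.-tuple G)) :
  definable_tuples M X -> interpretable M (singletons X).
Proof.
move=> dX; exists X, eq; split=> //; first last.
- have E v : X v -> [set u | X u /\ v = u] = [set v].
    by move=> Xv; apply/seteqP; split=> u /= => [[_ ->]|->].
  by apply/seteqP; split=> _ [v Xv <-]; exists v => //; rewrite E.
- by split=> // x y z _ _ _ ->.
- have := definable_graph (@Var G n) dX.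
  congr definable_tuples; apply/seteqP; split=> z /=.
    by case=> v Xv ->; exists v, v; rewrite eval_tuple_var.
  by case=> v [_ [Xv _ <- ->]]; exists v; rewrite ?eval_tuple_var.
Qed.

Lemma singleton_inj T (x y : T) : [set x] = [set y] -> x = y.
Proof. by move=> E; have : [set y] x by rewrite -E. Qed.

(** This leads back from the interpretable sets of the axioms to definable sets of tuples. By
    reflexivity the class of [v] contains [v]; being a singleton, it is [[set v]], so the set
    underlying the quotient is the required [Y]. *)
Lemma sub_interpretable_singletons n (X : set (n.-tuple G)) S :
  interpretable M S -> S `<=` singletons X ->
  exists Y, [/\ definable_tuples M Y, Y `<=` X & S = singletons Y].
Proof.
case=> Y [E [dY _ [Erefl _ _] ->]] sYX; exists Y.
have sing v : Y v -> [set u | Y u /\ E v u] = [set v] /\ X v.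
  move=> Yv; have /sYX [u Xu eu] : quotient_set Y E [set u | Y u /\ E v u].
    by exists v.
  have : [set u] v by rewrite eu; split=> //; exact: Erefl.
  by move=> /= vu; split; [rewrite -eu vu|rewrite vu].
split=> //; first by move=> v /sing [].
by apply/seteqP; split=> _ [v Yv <-]; exists v => //; case: (sing v Yv).
Qed.

Lemma definable_fun_eval m n (t : 'I_n -> term G m) X Y :
  definable_tuples M X -> {homo eval_tuple t : v / X v >-> Y v} ->
  definable_fun M (singletons X) (singletons Y) (fun C => eval_tuple t @` C).
Proof.
move=> dX XY; split=> [_ [v Xv <-]|].
  by exists (eval_tuple t v); [exact: XY|rewrite image_set1].
have := interpretable_singletons (definable_graph t dX).
have E v : class_pair [set v] (eval_tuple t @` [set v])
    = [set cat_tuple v (eval_tuple t v)].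
  rewrite image_set1; apply/seteqP; split=> z /=; first by case=> _ [_ [-> -> ->]].
  by move=> ->; exists v, (eval_tuple t v).
congr interpretable; apply/seteqP; split.
  by move=> _ [_ [v Xv ->] <-]; exists [set v]; [exists v|rewrite E].
by move=> _ [_ [v Xv <-] <-]; exists (cat_tuple v (eval_tuple t v));
  [exists v|rewrite E].
Qed.

Lemma fibre_singletons m n (t : 'I_n -> term G m) X u :
  fibre (singletons X) (fun C => eval_tuple t @` C) [set u] =
  singletons (X `&` [set v | eval_tuple t v = u]).
Proof.
apply/seteqP; split=> C.
  case=> -[v Xv <-]; rewrite image_set1 => e; exists v => //.
  by split=> //; exact: (singleton_inj e).
by case=> v [Xv <-] <-; split; [exists v|rewrite image_set1].
Qed.

Lemma definable_fibre m n (t : 'I_n -> term G m) X u :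
  definable_tuples M X ->
  definable_tuples M (X `&` [set v | eval_tuple t v = u]).
Proof.
move=> dX; apply: definable_tuplesI => //.
rewrite (_ : mkset _ = [set v | forall i, i \in enum 'I_n ->
    eval v (t i) = eval v (Param m (tnth u i))]).
  by apply: definable_tuples_forall => i; apply: definable_tuples_eq.
apply/seteqP; split=> v /=; first by move=> <- i _; rewrite tnth_mktuple.
by move=> H; apply: eq_from_tnth => i; rewrite tnth_mktuple H ?mem_enum.
Qed.

End Definability.

(** * Rank *)

Section Rank.
Variables (L : signature) (G : groupType) (M : structure L G).
Variables (rk : rank_function G) (hrk : ranked M rk).

Definition rkt n (X : set (n.-tuple G)) : nat := rk (singletons X).

(* The value of [rk] on the empty set is meaningless, hence the first clause. *)
Definition rank_ge n k (X : set (n.-tuple G)) : Prop :=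
  X !=set0 /\ (k <= rkt X)%N.

Lemma singletons1 n (X : set (n.-tuple G)) v : singletons X [set v] <-> X v.
Proof.
split=> [[u Xu /= e]|Xv]; last by exists v.
by rewrite -(singleton_inj e).
Qed.

Lemma singletons_neq0 n (X : set (n.-tuple G)) :
  singletons X !=set0 <-> X !=set0.
Proof.
by split=> [[_ [v Xv _]]|[v Xv]]; [exists v|exists [set v]; apply/singletons1].
Qed.

Lemma sub_singletons n (X Y : set (n.-tuple G)) :
  singletons X `<=` singletons Y <-> X `<=` Y.
Proof.
split=> XY; first by move=> v /singletons1 /XY /singletons1.
by move=> _ [v Xv <-]; apply/singletons1/XY.
Qed.

Lemma singletons_inj n (X Y : set (n.-tuple G)) :
  singletons X = singletons Y -> X = Y.
Proof. by move=> /seteqP[/sub_singletons ? /sub_singletons ?]; apply/seteqP. Qed.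

(** The monotonicity axiom, freed from quotients: the interpretable pieces of [singletons X] come
    from definable subsets of [X]. *)
Lemma rank_ge_succ n k (X : set (n.-tuple G)) : definable_tuples M X ->
  rank_ge k.+1 X <-> exists F : nat -> set (n.-tuple G),
    [/\ forall i, definable_tuples M (F i) /\ F i `<=` X,
        forall i, rank_ge k (F i)
      & trivIset [set: nat] F].
Proof.
move=> dX; have iX := interpretable_singletons dX; split.
  move=> [X0 ltk]; have SX0 : singletons X !=set0 by apply/singletons_neq0.
  have [/(_ ltk) [F [dF F0 tF Fk]] _] := ranked_monotone hrk k iX SX0.
  have /choice[H HF] i := sub_interpretable_singletons (dF i).1 (dF i).2.
  exists H; split=> [i|i|i j _ _ [v [Hi Hj]]]; have [dH HX FH] := HF i => //.
    by split; [apply/singletons_neq0; rewrite -FH|rewrite /rkt -FH].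
  apply: tF => //; exists [set v]; split; first by rewrite FH; apply/singletons1.
  by have [_ _ ->] := HF j; apply/singletons1.
move=> [F [dF Fk tF]].
have X0 : X !=set0 by have [[v /(dF 0%N).2 Xv] _] := Fk 0%N; exists v.
split=> //; have SX0 : singletons X !=set0 by apply/singletons_neq0.
apply/(ranked_monotone hrk k iX SX0); exists (fun i => singletons (F i)).
split=> [i|i|i j _ _ [_ [[v Fi <-] /singletons1 Fj]]|i].
- by split; [apply/interpretable_singletons/(dF i).1|
    apply/sub_singletons/(dF i).2].
- by apply/singletons_neq0; have [] := Fk i.
- by apply: tF => //; exists v.
- by have [] := Fk i.
Qed.

Lemma rank_ge_sub n k (X Y : set (n.-tuple G)) :
  definable_tuples M X -> definable_tuples M Y -> X `<=` Y ->
  rank_ge k X -> rank_ge k Y.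
Proof.
move=> dX dY XY; case: k => [|k]; first by case=> -[v /XY Yv] _; split=> //; exists v.
move=> /(rank_ge_succ _ dX) [F [dF Fk tF]]; apply/(rank_ge_succ _ dY).
by exists F; split=> // i; split; [|apply: subset_trans XY]; have [] := dF i.
Qed.

Lemma rkt_sub n (X Y : set (n.-tuple G)) :
  definable_tuples M X -> definable_tuples M Y -> X `<=` Y -> X !=set0 ->
  (rkt X <= rkt Y)%N.
Proof.
by move=> dX dY XY X0; case: (rank_ge_sub dX dY XY (conj X0 (leqnn (rkt X)))).
Qed.

Lemma infinitely_often (P : nat -> Prop) :
  (forall m, exists2 i, (m <= i)%N & P i) ->
  exists2 phi : nat -> nat, injective phi & forall i, P (phi i).
Proof.
move=> Pinf; have /choice[h hP] m : exists i, (m <= i)%N /\ P i.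
  by have [i mi Pi] := Pinf m; exists i.
pose phi := fix phi i := if i is j.+1 then h (phi j).+1 else h 0%N.
have phiS i j : (i < j)%N -> (phi i < phi j)%N.
  elim: j => // j IH; rewrite ltnS leq_eqVlt => /orP[/eqP->|/IH lt].
    by have [] := hP (phi j).+1.
  by apply: (ltn_trans lt); have [] := hP (phi j).+1.
exists phi => [i j e|[|i]]; try by have [] := hP _.
- by case: (ltngtP i j) => // /phiS; rewrite e ltnn.
- by have [] := hP 0%N.
- by have [] := hP (phi i).+1.
Qed.

(** Induction on [k]. Each of infinitely many disjoint pieces of the union keeps rank at least [k]
    on its part in [X] or on its part in [Y], so one of the two sides receives infinitely many large
    parts. *)
Lemma rank_geU n k (X Y : set (n.-tuple G)) :
  definable_tuples M X -> definable_tuples M Y ->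
  rank_ge k (X `|` Y) -> rank_ge k X \/ rank_ge k Y.
Proof.
elim: k X Y => [|k IH] X Y dX dY.
  by case=> -[v [Xv|Yv]] _; [left|right]; split=> //; exists v.
move=> /(rank_ge_succ _ (definable_tuplesU dX dY)) [F [dF Fk tF]].
have dI Z i : definable_tuples M Z -> definable_tuples M (F i `&` Z).
  by move=> dZ; apply: definable_tuplesI => //; have [] := dF i.
have key Z : definable_tuples M Z ->
    (forall m, exists2 i, (m <= i)%N & rank_ge k (F i `&` Z)) ->
    rank_ge k.+1 Z.
  move=> dZ /infinitely_often[phi phi_inj Zphi]; apply/rank_ge_succ => //.
  exists (fun i => F (phi i) `&` Z); split=> // [i|i j _ _ [v [[Fi _] [Fj _]]]].
    by split; [exact: dI|move=> v []].
  by apply/phi_inj/tF => //; exists v.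
have [XF|] := pselect (forall m, exists2 i, (m <= i)%N & rank_ge k (F i `&` X)).
  by left; apply: key.
move=> /existsNP[m notX]; right; apply: key => // m'.
(* Past [m] the part in [X] is never large; past [m'] the index is one of those asked for. *)
exists (maxn m m'); first exact: leq_maxr.
have : rank_ge k ((F (maxn m m') `&` X) `|` (F (maxn m m') `&` Y)).
  rewrite -setIUr; have [_ sF] := dF (maxn m m').
  by rewrite (setIidl sF).
case/IH => //; [exact: dI|exact: dI|move=> XF].
by case: notX; exists (maxn m m') => //; exact: leq_maxl.
Qed.

Lemma rank_ge_exists n k (I : eqType) (s : seq I) (P : I -> set (n.-tuple G)) :
  (forall i, definable_tuples M (P i)) ->
  rank_ge k [set v | exists2 i, i \in s & P i v] ->
  exists2 i, i \in s & rank_ge k (P i).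
Proof.
move=> dP; elim: s => [|i s IH]; first by case=> -[v []].
rewrite (_ : mkset _ = P i `|` [set v | exists2 i, i \in s & P i v]).
  case/rank_geU => //; first exact: definable_tuples_exists.
    by exists i; rewrite // mem_head.
  by case/IH=> j js Pj; exists j; rewrite // inE js orbT.
apply/seteqP; split=> v /=.
  by case=> j; rewrite inE => /orP[/eqP->|js] Pj; [left|right; exists j].
case=> [Pi|[j js Pj]]; first by exists i; rewrite // mem_head.
by exists j; rewrite // inE js orbT.
Qed.

Lemma rkt_set1 n (v : n.-tuple G) : rkt [set v] = 0%N.
Proof.
apply/eqP; rewrite -leqn0 leqNgt; apply/negP => lt.
have dv : definable_tuples M [set v].
  have := definable_fibre (@Var G n) v (definable_tuplesT M n).
  by congr definable_tuples; rewrite setTI; apply/seteqP;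
    split=> u /=; rewrite eval_tuple_var.
have /(rank_ge_succ _ dv) [F [dF Fk tF]] : rank_ge 1 [set v] by split; [exists v|].
suff : 0%N = 1%N by [].
apply: tF => //; exists v; split.
  by have [[u Fu] _] := Fk 0%N; have <- := (dF 0%N).2 _ Fu.
by have [[u Fu] _] := Fk 1%N; have <- := (dF 1%N).2 _ Fu.
Qed.

(** * Fibres of a map given by terms *)

Section Fibration.
Variables (m n : nat) (t : 'I_n -> term G m).
Variables (X : set (m.-tuple G)) (Y : set (n.-tuple G)).
Hypotheses (dX : definable_tuples M X) (dY : definable_tuples M Y).
Hypothesis XY : {homo eval_tuple t : v / X v >-> Y v}.

Definition fib u := X `&` [set v | eval_tuple t v = u].

Lemma rkt_additive k : X !=set0 ->
  (forall u, Y u -> fib u !=set0 /\ rkt (fib u) = k) ->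
  rkt X = (rkt Y + k)%N.
Proof.
move=> X0 Yk; apply: (ranked_additive hrk (interpretable_singletons dX)
  (interpretable_singletons dY) _ (definable_fun_eval dX XY)).
  exact/singletons_neq0.
move=> _ [u /Yk[u0 uk] <-]; rewrite fibre_singletons.
by split=> //; apply/singletons_neq0.
Qed.

(** The fibres are single points, which have rank zero, so additivity applies with [k = 0]. *)
Lemma rkt_inj : X !=set0 -> {in X &, injective (eval_tuple t)} ->
  Y `<=` eval_tuple t @` X -> rkt X = rkt Y.
Proof.
move=> X0 inj sur; rewrite (rkt_additive (k := 0)) ?addn0// => u /sur[v Xv <-].
suff -> : fib (eval_tuple t v) = [set v] by split; [exists v|exact: rkt_set1].
apply/seteqP; split=> [w [Xw /= e]|_ ->//]; apply: inj => //; exact: mem_set.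
Qed.

Definition stratum k := [set u | [/\ Y u, fib u !=set0 & rkt (fib u) = k]].

Lemma definable_stratum k : definable_tuples M (stratum k).
Proof.
have iS := ranked_definable hrk k (interpretable_singletons dX)
  (interpretable_singletons dY) (definable_fun_eval dX XY).
have [|Z [dZ _]] := sub_interpretable_singletons (X := Y) iS; first by move=> D [].
rewrite (_ : mkset _ = singletons (stratum k)); first by move=> /singletons_inj ->.
apply/seteqP; split.
  move=> _ [[u Yu <-]]; rewrite fibre_singletons => /singletons_neq0 u0 uk.
  by exists u.
move=> _ [u [Yu u0 uk] <-]; split; rewrite ?fibre_singletons//.
  exact/singletons1.
exact/singletons_neq0.
Qed.

Lemma fib_stratum k u : stratum k u ->
  X `&` eval_tuple t @^-1` stratum k `&` [set v | eval_tuple t v = u] = fib u.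
Proof.
move=> su; apply/seteqP; split=> v; first by case=> -[].
by case=> Xv /= e; split=> //; split=> //=; rewrite e.
Qed.

End Fibration.

Lemma rkt_stratum m n (t : 'I_n -> term G m) X Y k :
  definable_tuples M X -> definable_tuples M Y ->
  {homo eval_tuple t : v / X v >-> Y v} -> stratum t X Y k !=set0 ->
  rkt (X `&` eval_tuple t @^-1` stratum t X Y k)
  = (rkt (stratum t X Y k) + k)%N.
Proof.
move=> dX dY XY [u su]; have dS := definable_stratum dX dY XY k.
apply: (rkt_additive (t := t)) => //.
- exact/definable_tuplesI/definable_tuples_preimage.
- by move=> v [].
- have [_ [v [Xv /= e]] _] := su; exists v; split=> //=; by rewrite e.
- move=> w sw; have [_ w0 wk] := sw.
  by rewrite /fib (fib_stratum sw).
Qed.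

(** Fibres have rank at most that of [X], so [X] is a finite union of preimages of strata. One of
    these has full rank in [X], and additivity holds on it. *)
Lemma dominant_stratum m n (t : 'I_n -> term G m) X Y :
  definable_tuples M X -> definable_tuples M Y ->
  {homo eval_tuple t : v / X v >-> Y v} -> X !=set0 ->
  exists k, stratum t X Y k !=set0 /\ rkt X = (rkt (stratum t X Y k) + k)%N.
Proof.
move=> dX dY XY X0; have dS k := definable_stratum dX dY XY k.
have dP k : definable_tuples M (X `&` eval_tuple t @^-1` stratum t X Y k).
  exact/definable_tuplesI/definable_tuples_preimage.
have : rank_ge (rkt X) [set v | exists2 k, k \in iota 0 (rkt X).+1 &
    (X `&` eval_tuple t @^-1` stratum t X Y k) v].
  apply: (rank_ge_sub _ _ _ (conj X0 (leqnn _))) => //; first exact: definable_tuples_exists.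
  move=> v Xv; exists (rkt (fib t X (eval_tuple t v))); last first.
    by split=> //; split=> //; [exact: XY|exists v].
  rewrite mem_iota /= add0n ltnS; apply: rkt_sub => //; last by exists v.
    exact: definable_fibre.
  by move=> w [].
case/rank_ge_exists => // k _ [[v [Xv sv]] le]; exists k; split.
  by exists (eval_tuple t v).
rewrite -rkt_stratum//; last by exists (eval_tuple t v).
by apply/eqP; rewrite eqn_leq le /=; apply: rkt_sub => //; exists v.
Qed.

Lemma rkt_fib_le m n (t : 'I_n -> term G m) X Y b :
  definable_tuples M X -> definable_tuples M Y ->
  {homo eval_tuple t : v / X v >-> Y v} -> X !=set0 ->
  (forall u, Y u -> fib t X u !=set0 -> (rkt (fib t X u) <= b)%N) ->
  (rkt X <= rkt Y + b)%N.
Proof.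
move=> dX dY XY X0 Yb; have [k [s0 ->]] := dominant_stratum dX dY XY X0.
apply: leq_add; last by case: s0 => u [Yu u0 <-]; exact: Yb.
by apply: rkt_sub => //; [exact: definable_stratum|move=> u []].
Qed.

(** Here the strata themselves cover [Y], again finitely many, so one has full rank in [Y]; its
    preimage in [X] gives the inequality. *)
Lemma generic_stratum m n (t : 'I_n -> term G m) X Y :
  definable_tuples M X -> definable_tuples M Y ->
  {homo eval_tuple t : v / X v >-> Y v} -> Y !=set0 ->
  (forall u, Y u -> fib t X u !=set0) ->
  exists k, [/\ stratum t X Y k !=set0, rkt (stratum t X Y k) = rkt Y
    & (rkt Y + k <= rkt X)%N].
Proof.
move=> dX dY XY Y0 sur; have dS k := definable_stratum dX dY XY k.
have : rank_ge (rkt Y) [set u | exists2 k, k \in iota 0 (rkt X).+1 &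
    stratum t X Y k u].
  apply: (rank_ge_sub _ _ _ (conj Y0 (leqnn _))) => //; first exact: definable_tuples_exists.
  move=> u Yu; exists (rkt (fib t X u)); last by split=> //; exact: sur.
  rewrite mem_iota /= add0n ltnS; apply: rkt_sub => //; last exact: sur.
    exact: definable_fibre.
  by move=> w [].
case/rank_ge_exists => // k _ [s0 le]; exists k; split=> //.
  by apply/eqP; rewrite eqn_leq le andbT; apply: rkt_sub => // u [].
apply: (@leq_trans (rkt (stratum t X Y k) + k)); first by rewrite leq_add2r.
rewrite -rkt_stratum//; apply: rkt_sub => //; last 1 first.
- by case: s0 => u su; have [_ [v [Xv e]] _] := su; exists v; split; rewrite //= e.
- exact/definable_tuplesI/definable_tuples_preimage.
Qed.

End Rank.

(** * Binary relations as definable families of sets *)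

Section Binary.
Variables (L : signature) (G : groupType) (M : structure L G).

Definition unary (X : set G) : set (1.-tuple G) := [set v | X (thead v)].

Definition binary (R : G -> G -> Prop) : set (2.-tuple G) :=
  [set v | R (tnth v ord0) (tnth v ord_max)].

Definition definable2 R := definable_tuples M (binary R).

Definition pair_subst n (s t : term G n) (i : 'I_2) : term G n :=
  if i == ord0 then s else t.

Lemma binary_pair_subst n (s t : term G n) R v :
  binary R (eval_tuple (pair_subst s t) v) <-> R (eval v s) (eval v t).
Proof. by rewrite /binary /= !tnth_mktuple. Qed.

Lemma definable2_term n (s t : term G n) R : definable2 R ->
  definable_tuples M [set v | R (eval v s) (eval v t)].
Proof.
move=> /(definable_tuples_preimage (pair_subst s t)); congr definable_tuples.
by apply/seteqP; split=> v => [/binary_pair_subst|Rv]; last exact/binary_pair_subst.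
Qed.

Lemma definable2_flip R : definable2 R -> definable2 (fun x y => R y x).
Proof. exact: (definable2_term (Var G (ord_max : 'I_2)) (Var G ord0)). Qed.

Lemma definable2_section R a : definable2 R -> definable M (R a).
Proof.
move=> dR; apply/definable1E.
exact: (definable2_term (Param 1 a) (Var G ord0)).
Qed.

Definition dom (R : G -> G -> Prop) : set G := [set a | exists b, R a b].

Lemma definable_dom R : definable2 R -> definable M (dom R).
Proof.
move=> /definable2_flip/definable_tuples_ex dR; apply/definable1E.
move: dR; congr definable_tuples; apply/seteqP; split=> v /= [b Rb]; exists b;
  by move: Rb; rewrite /binary /= tnth0 (_ : ord_max = lift ord0 ord0) ?tnthS//;
  apply: val_inj.
Qed.

Lemma tuple2E (v : 2.-tuple G) : v = [tuple tnth v ord0; tnth v ord_max].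
Proof.
apply: eq_from_tnth => i; case: (unliftP ord0 i) => [j|] ->; last by rewrite tnth0.
by rewrite tnthS ord1 tnth0; congr tnth; apply: val_inj.
Qed.

Lemma definable2_mem (X : set G) (t : term G 2) :
  definable M X -> definable2 (fun x y => X (eval [tuple x; y] t)).
Proof.
move=> /(definable_term t); congr definable_tuples.
by apply/seteqP; split=> v; rewrite /binary /= -tuple2E.
Qed.

Lemma definable2I (R S : G -> G -> Prop) : definable2 R -> definable2 S ->
  definable2 (fun x y => R x y /\ S x y).
Proof. exact: definable_tuplesI. Qed.

Variables (rk : rank_function G) (hrk : ranked M rk).

Definition rk1 (X : set G) := rkt rk (unary X).

Definition rk2 (R : G -> G -> Prop) := rkt rk (binary R).

Lemma rk_points (X : set G) : rk (points X) = rk1 X.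
Proof.
rewrite /rk1 /rkt; congr rk; apply/seteqP; split=> [_ [x Xx <-]|_ [v Xv <-]].
  by exists [tuple x].
by exists (thead v) => //; rewrite -tuple1E.
Qed.

Lemma unary_neq0 X : unary X !=set0 <-> X !=set0.
Proof. by split=> [[v Xv]|[x Xx]]; [exists (thead v)|exists [tuple x]]. Qed.

Lemma unary_sub X Y : X `<=` Y -> unary X `<=` unary Y.
Proof. by move=> XY v /XY. Qed.

Definition rank1_ge k (X : set G) := X !=set0 /\ (k <= rk1 X)%N.

Lemma rank1_geE k X : rank1_ge k X <-> rank_ge rk k (unary X).
Proof. by rewrite /rank1_ge -unary_neq0. Qed.

Lemma rank1_ge_sub k X Y : definable M X -> definable M Y -> X `<=` Y ->
  rank1_ge k X -> rank1_ge k Y.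
Proof.
move=> /definable1E dX /definable1E dY XY /rank1_geE Xk; apply/rank1_geE.
by apply: (rank_ge_sub hrk dX dY _ Xk); exact: unary_sub.
Qed.

Lemma rk1_sub X Y : definable M X -> definable M Y -> X `<=` Y ->
  X !=set0 -> (rk1 X <= rk1 Y)%N.
Proof. by move=> dX dY XY X0; have [] := rank1_ge_sub dX dY XY (conj X0 (leqnn _)). Qed.

Lemma rank1_geU k X Y : definable M X -> definable M Y ->
  rank1_ge k (X `|` Y) -> rank1_ge k X \/ rank1_ge k Y.
Proof.
move=> /definable1E dX /definable1E dY /rank1_geE.
by case/(rank_geU hrk dX dY) => /rank1_geE; [left|right].
Qed.

Lemma rank1_ge_exists k (I : eqType) (s : seq I) (P : I -> set G) :
  (forall i, definable M (P i)) ->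
  rank1_ge k [set x | exists2 i, i \in s & P i x] ->
  exists2 i, i \in s & rank1_ge k (P i).
Proof.
move=> dP /rank1_geE /(rank_ge_exists hrk (P := fun i => unary (P i))).
case=> [i|i si Pi]; first exact/definable1E.
by exists i => //; apply/rank1_geE.
Qed.

Lemma rank1_ge_succ k X (F : nat -> set G) : definable M X ->
  (forall i, definable M (F i)) -> (forall i, F i `<=` X) ->
  (forall i, rank1_ge k (F i)) ->
  (forall i j, (i < j)%N -> F i `&` F j = set0) -> rank1_ge k.+1 X.
Proof.
move=> /definable1E dX dF FX Fk tF; apply/rank1_geE/(rank_ge_succ hrk) => //.
exists (fun i => unary (F i)); split=> [i|i|].
- by split; [exact/definable1E|exact: unary_sub].
- exact/rank1_geE.
- apply: ltn_trivIset => i j ij; apply/seteqP; split=> // v [Fj Fi].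
  by have := tF _ _ ij; rewrite -subset0 => /(_ (thead v)); apply.
Qed.

Lemma rk1_inj (t : term G 1) X Y (f := fun x => eval [tuple x] t) :
  definable M X -> definable M Y -> X !=set0 ->
  {homo f : x / X x >-> Y x} -> {in X &, injective f} -> Y `<=` f @` X ->
  rk1 X = rk1 Y.
Proof.
move=> /definable1E dX /definable1E dY X0 XY inj sur.
have et v : eval_tuple (fun=> t : term G 1) v = [tuple f (thead v)] :> 1.-tuple G.
  by apply: eq_from_tnth => i; rewrite tnth_mktuple ord1 tnth0 /f -tuple1E.
apply: (rkt_inj hrk (t := fun=> t) dX dY) => [v Xv||u v|u /sur[x Xx e]].
- by rewrite et; exact: XY.
- exact/unary_neq0.
- move=> /set_mem Xu /set_mem Xv; rewrite !et => /(congr1 (@thead _ _)) /inj e.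
  by rewrite (tuple1E u) (tuple1E v) e//; exact: mem_set.
- by exists [tuple x] => //; rewrite et theadE e -tuple1E.
Qed.

Definition fst_subst (i : 'I_1) : term G 2 := Var G ord0.

Lemma fst_substE v : eval_tuple fst_subst v = [tuple tnth v ord0].
Proof. by apply: eq_from_tnth => i; rewrite tnth_mktuple ord1 tnth0. Qed.

Lemma fst_subst_homo R : {homo eval_tuple fst_subst : v / binary R v >-> unary (dom R) v}.
Proof. by move=> v Rv; rewrite fst_substE; exists (tnth v ord_max). Qed.

Lemma fib_fst R u : fib fst_subst (binary R) u !=set0 <-> dom R (thead u).
Proof.
split=> [[v [Rv /= <-]]|[b Rb]]; first exact: fst_subst_homo.
by exists [tuple thead u; b]; split; rewrite //= fst_substE -tuple1E.
Qed.

Lemma rkt_fib_fst R u : definable2 R -> dom R (thead u) ->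
  rkt rk (fib fst_subst (binary R) u) = rk1 (R (thead u)).
Proof.
move=> dR [b Rb]; set a := thead u in Rb *.
(* The map sending [b] to the pair of [a] and [b] is a bijection from the section onto the fibre. *)
pose t := pair_subst (Param 1 a) (Var G ord0).
have et v : eval_tuple t v = [tuple a; thead v].
  by rewrite [LHS]tuple2E !tnth_mktuple.
rewrite /rk1; apply/esym/(rkt_inj hrk (t := t)) => [|||| v w _ _|v [Rv /= e]].
- exact/definable1E/definable2_section.
- exact: definable_fibre.
- move=> v Rv; rewrite et; split=> //=; rewrite fst_substE.
  by rewrite [u]tuple1E.
- by apply/unary_neq0; exists b.
- rewrite !et => /(congr1 (fun z => tnth z ord_max)) e.
  by rewrite [v]tuple1E [w]tuple1E; congr [tuple _]; exact: e.
- have ea : tnth v ord0 = a by rewrite /a -e fst_substE.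
  exists [tuple tnth v ord_max]; last by rewrite et theadE -ea -tuple2E.
  by rewrite /unary /= theadE -ea.
Qed.

Lemma definable_rk1_section R k : definable2 R ->
  definable M [set a | dom R a /\ rk1 (R a) = k].
Proof.
move=> dR; have /definable1E dD := definable_dom dR; apply/definable1E.
have := definable_stratum hrk dR dD (@fst_subst_homo R) k.
congr definable_tuples; apply/seteqP; split=> u.
  by case=> Du _; rewrite rkt_fib_fst.
by case=> /= Du e; split; rewrite ?rkt_fib_fst//; apply/fib_fst.
Qed.

Lemma binary_neq0 R : dom R !=set0 -> binary R !=set0.
Proof. by case=> a [b Rab]; exists [tuple a; b]. Qed.

Lemma rk2_additive R k : definable2 R -> dom R !=set0 ->
  (forall a, dom R a -> rk1 (R a) = k) -> rk2 R = (rk1 (dom R) + k)%N.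
Proof.
move=> dR D0 Rk; have /definable1E dD := definable_dom dR.
apply: (rkt_additive hrk dR dD (@fst_subst_homo R)); first exact: binary_neq0.
by move=> u Du; rewrite rkt_fib_fst//; split; [apply/fib_fst|exact: Rk].
Qed.

Lemma rk2_le R b : definable2 R -> dom R !=set0 ->
  (forall a, dom R a -> (rk1 (R a) <= b)%N) -> (rk2 R <= rk1 (dom R) + b)%N.
Proof.
move=> dR D0 Rb; have /definable1E dD := definable_dom dR.
apply: (rkt_fib_le hrk dR dD (@fst_subst_homo R)); first exact: binary_neq0.
by move=> u Du _; rewrite rkt_fib_fst//; exact: Rb.
Qed.

Lemma generic_section R : definable2 R -> dom R !=set0 ->
  exists k T, [/\ definable M T, T `<=` dom R, rank1_ge (rk1 (dom R)) T,
    forall a, T a -> rk1 (R a) = k & (rk1 (dom R) + k <= rk2 R)%N].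
Proof.
move=> dR D0; have /definable1E dD := definable_dom dR.
have [u Du|k [s0 sD le]] := generic_stratum hrk dR dD (@fst_subst_homo R)
  ((unary_neq0 _).2 D0); first exact/fib_fst.
exists k, [set a | dom R a /\ rk1 (R a) = k].
have es : stratum rk fst_subst (binary R) (unary (dom R)) k =
    unary [set a | dom R a /\ rk1 (R a) = k].
  apply/seteqP; split=> u; first by case=> Du _; rewrite rkt_fib_fst.
  by case=> /= Du e; split; rewrite ?rkt_fib_fst//; apply/fib_fst.
split=> //; first exact: definable_rk1_section.
- by move=> a [].
- by apply/rank1_geE; rewrite -es; split=> //; rewrite sD.
- by move=> a [].
Qed.

(** This permits double counting: the rank of a set of pairs is computed along either coordinate. *)
Lemma rk2_flip R : definable2 R -> dom R !=set0 -> rk2 (fun x y => R y x) = rk2 R.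
Proof.
move=> dR D0; pose t := pair_subst (Var G (ord_max : 'I_2)) (Var G ord0).
have et v : eval_tuple t v = [tuple tnth v ord_max; tnth v ord0].
  by rewrite [LHS]tuple2E !tnth_mktuple.
rewrite /rk2; apply/esym/(rkt_inj hrk (t := t)) => // [|||v w _ _|v Rv].
- exact: definable2_flip.
- by move=> v Rv; rewrite et.
- exact: binary_neq0.
- rewrite !et => e; rewrite (tuple2E v) (tuple2E w).
  have e0 := congr1 (fun z => tnth z ord_max) e.
  have e1 := congr1 (fun z => tnth z ord0) e.
  by congr [tuple _; _]; [exact: e0|exact: e1].
- by exists [tuple tnth v ord_max; tnth v ord0]; rewrite // et -tuple2E.
Qed.

End Binary.

(** * Generic sets in a connected group *)

Lemma seq_dependent_choice (T : Type) (Q : seq T -> T -> Prop) :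
  (forall s, exists x, Q s x) ->
  exists u : nat -> T, forall i, Q (mkseq u i) (u i).
Proof.
move=> /choice[f Qf].
pose s := fix s i := if i is j.+1 then rcons (s j) (f (s j)) else [::].
exists (fun i => f (s i)) => i; suff -> : mkseq (fun i => f (s i)) i = s i by [].
elim: i => // i IH.
by rewrite /mkseq -addn1 iotaD map_cat /= add0n addn1 /= -IH cats1.
Qed.

(** When no finite part of [A] covers it, a greedy choice always finds a new element of [A] outside
    what the previous ones cover. *)
Lemma finite_cover_or_sequence (T : eqType) (A : set T) (E : T -> T -> Prop) :
  (exists2 s : seq T, (forall x, x \in s -> A x) &
     forall x, A x -> exists2 y, y \in s & E y x) \/
  (exists u : nat -> T, (forall i, A (u i)) /\
     forall i j, (i < j)%N -> ~ E (u i) (u j)).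
Proof.
have [cov|nocov] := pselect (exists2 s : seq T, (forall x, x \in s -> A x) &
     forall x, A x -> exists2 y, y \in s & E y x); [by left|right].
(* A default value for the choice on sequences not contained in [A]; over an empty type the empty
   sequence is a cover. *)
have [x0 _] : exists x : T, True.
  have [[x]|noT] := pselect (exists x : T, True); first by exists x.
  by case: nocov; exists [::] => // x; case: noT; exists x.
have /seq_dependent_choice[u uP] (s : seq T) : exists x, (forall y, y \in s -> A y) ->
    A x /\ forall y, y \in s -> ~ E y x.
  have [sA|] := pselect (forall y, y \in s -> A y); last by exists x0.
  have /existsNP[x /not_implyP[Ax nx]] : ~ forall x, A x -> exists2 y, y \in s & E y x.
    by move=> sE; apply: nocov; exists s.
  by exists x => _; split=> // y ys Eyx; apply: nx; exists y.
have Au i : forall y, y \in mkseq u i -> A y.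
  elim: i => // i IH y; rewrite /mkseq -addn1 iotaD map_cat mem_cat => /orP[/IH//|].
  by rewrite /= add0n inE => /eqP ->; have [] := uP i IH.
exists u; split=> [i|i j ij]; first by have [] := uP i (Au i).
have [_] := uP j (Au j); apply; apply/mapP; exists i => //.
by rewrite mem_iota add0n.
Qed.

Section Genericity.
Variables (L : signature) (G : groupType) (M : structure L G).
Variables (rk : rank_function G) (hrk : ranked M rk).

Local Notation rk1 := (rk1 rk).
Local Notation rank1_ge := (rank1_ge rk).

Lemma rk1_mull X g : definable M X -> X !=set0 -> rk1 [set x | X (g * x)] = rk1 X.
Proof.
move=> dX X0; apply/esym.
apply: (rk1_inj hrk (t := Mul (Param 1 g^-1) (Var G ord0))) => //.
- exact: definable_mull.
- by move=> x Xx /=; rewrite tnth0 mulVKg.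
- by move=> x y _ _ /=; rewrite !tnth0 => /mulgI.
- by move=> x Xx; exists (g * x) => //=; rewrite tnth0 mulKg.
Qed.

Lemma rk1_mulr X g : definable M X -> X !=set0 -> rk1 [set x | X (x * g)] = rk1 X.
Proof.
move=> dX X0; apply/esym.
apply: (rk1_inj hrk (t := Mul (Var G ord0) (Param 1 g^-1))) => //.
- exact: (definable_preimage (Mul (Var G ord0) (Param 1 g))).
- by move=> x Xx /=; rewrite tnth0 mulgVK.
- by move=> x y _ _ /=; rewrite !tnth0 => /mulIg.
- by move=> x Xx; exists (x * g) => //=; rewrite tnth0 mulgK.
Qed.

Lemma rank1_ge_mull k X g : definable M X ->
  rank1_ge k X -> rank1_ge k [set x | X (g * x)].
Proof.
move=> dX [[x Xx] Xk]; split; first by exists (g^-1 * x); rewrite /= mulVKg.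
by rewrite rk1_mull//; exists x.
Qed.

Lemma rank1_ge_mulr k X g : definable M X ->
  rank1_ge k X -> rank1_ge k [set x | X (x * g)].
Proof.
move=> dX [[x Xx] Xk]; split; first by exists (x * g^-1); rewrite /= mulgVK.
by rewrite rk1_mulr//; exists x.
Qed.

Local Notation rkG := (rk1 [set: G]).

Lemma not_rank1_ge_succ X : definable M X -> ~ rank1_ge rkG.+1 X.
Proof.
move=> dX /(rank1_ge_sub hrk dX (definableT M) (@subsetT _ _))[_].
by rewrite ltnn.
Qed.

Lemma rank1_ge_eq X : definable M X -> rank1_ge rkG X -> rk1 X = rkG.
Proof.
move=> dX [X0 le]; apply/eqP; rewrite eqn_leq le andbT.
by apply: (rk1_sub hrk) => //; exact: definableT.
Qed.

(* Among sets of full rank, Morley degree one. *)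
Definition irreducible Z := forall A B, definable M A -> definable M B ->
  A `<=` Z -> B `<=` Z -> A `&` B = set0 -> rank1_ge rkG A -> ~ rank1_ge rkG B.

(** Otherwise every definable subset of [X] of full rank contains two disjoint ones. Splitting the
    second one again and again leaves infinitely many disjoint first ones, which would give [X] rank
    above that of [G]. *)
Lemma irreducible_exists X : definable M X -> rank1_ge rkG X ->
  exists Z, [/\ definable M Z, Z `<=` X, rank1_ge rkG Z & irreducible Z].
Proof.
move=> dX Xn; apply: contrapT => nZ.
pose good (Y : set G) := [/\ definable M Y, Y `<=` X & rank1_ge rkG Y].
have /choice[f fP] (Y : set G) : exists AB : set G * set G, good Y ->
    [/\ good AB.1, good AB.2, AB.1 `<=` Y, AB.2 `<=` Y & AB.1 `&` AB.2 = set0].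
  have [gY|] := pselect (good Y); last by exists (X, X).
  have [dY YX Yn] := gY; apply: contrapT => nAB; apply: nZ; exists Y; split=> //.
  move=> A B dA dB AY BY AB0 An Bn; apply: nAB; exists (A, B) => _.
  by split=> //; split=> //; apply: subset_trans YX.
pose Y := fix Y i := if i is j.+1 then (f (Y j)).2 else X.
have gY i : good (Y i) by elim: i => [|i /fP[]//]; split.
have Ymono i j : (i <= j)%N -> Y j `<=` Y i.
  elim: j => [|j IH]; first by rewrite leqn0 => /eqP->.
  rewrite leq_eqVlt => /orP[/eqP->//|/IH]; apply: subset_trans.
  by have [] := fP _ (gY j).
apply: (@not_rank1_ge_succ X dX).
apply: (rank1_ge_succ hrk (F := fun i => (f (Y i)).1)) => // [i|i|i|i j ij].
- by have [[]] := fP _ (gY i).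
- by have [[]] := fP _ (gY i).
- by have [[]] := fP _ (gY i).
- have [_ _ _ _ AB0] := fP _ (gY i).
  have [_ _ sub _ _] := fP _ (gY j).
  rewrite -subset0 => x [Fi /sub Yj]; rewrite -AB0; split=> //.
  exact: (Ymono i.+1 j).
Qed.

Hypothesis hconn : connected_definable M [set: G].

Lemma connected_finite_index S : definable_subgroup M S ->
  (exists s : seq G, forall g, exists2 f, f \in s & S (f^-1 * g)) ->
  S = [set: G].
Proof.
move=> dS [s sP]; have [_ [_ _ /(_ S dS) TS]] := hconn.
apply/seteqP; split=> //; apply: TS; split=> //.
apply: (@sub_finite_set _ _ [set left_coset f S | f in [set` s]]).
  move=> _ [g _ <-]; have [f fs Sfg] := sP g; exists f => //.
  have [[_ SM SV] _] := dS; apply/seteqP; split=> _ [h Sh <-].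
    exists (g^-1 * f * h); last by rewrite !mulgA mulgV mul1g.
    by apply: SM => //; rewrite -[f]invgK -invgM; exact: SV.
  by exists (f^-1 * g * h); [exact: SM|rewrite !mulgA mulgV mul1g].
exact/finite_image/finite_seq.
Qed.

Definition stab_rel (Z : set G) (g x : G) := Z x /\ Z (g^-1 * x).

Lemma definable2_stab_rel Z : definable M Z -> definable2 M (stab_rel Z).
Proof.
move=> dZ; exact: (definable2I (definable2_mem (Var G ord_max) dZ)
  (definable2_mem (Mul (Defs.Inv (Var G ord0)) (Var G ord_max)) dZ)).
Qed.

(** The section [stab_rel Z g] is the intersection of [Z] and [gZ]. The elements [g] for which it
    has full rank form a definable subgroup of finite index, hence all of [G] by connectedness. *)
Lemma generic_stab Z : definable M Z -> rank1_ge rkG Z -> irreducible Z ->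
  forall g, rank1_ge rkG (stab_rel Z g).
Proof.
move=> dZ Zn irr; pose S := [set g | rank1_ge rkG (stab_rel Z g)].
have dR := definable2_stab_rel dZ.
have dRg g := definable2_section g dR.
have dS : definable M S.
  have := definable_rk1_section hrk rkG dR; congr definable.
  apply/seteqP; split=> g; first by case=> -[x Rx] e; split; [exists x|rewrite e].
  by move=> Sg; split; [case: Sg|exact: rank1_ge_eq].
(* Irreducibility passes to the translate of [Z] by [g^-1]: two of its subsets of full rank have an
   intersection of full rank. *)
have irr_g g A B : definable M A -> definable M B ->
    (forall x, A x -> Z (g * x)) -> (forall x, B x -> Z (g * x)) ->
    rank1_ge rkG A -> rank1_ge rkG B -> rank1_ge rkG (A `&` B).
  move=> dA dB AZ BZ An Bn; apply: contrapT => nAB.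
  have AD : rank1_ge rkG (A `\` B).
    have : rank1_ge rkG ((A `\` B) `|` (A `&` B)).
      by rewrite setUC setUIDK.
    case/(rank1_geU hrk) => //; [exact: definableD|exact: definableI].
  apply: (irr [set x | (A `\` B) (g^-1 * x)] [set x | B (g^-1 * x)]).
  - exact/definable_mull/definableD.
  - exact/definable_mull.
  - by move=> x [/AZ]; rewrite mulVKg.
  - by move=> x /BZ; rewrite mulVKg.
  - by rewrite -subset0 => x [[]].
  - by apply: rank1_ge_mull => //; exact: definableD.
  - exact: rank1_ge_mull.
suff ST : S = setT by move=> g; have : S g by rewrite ST.
apply: connected_finite_index.
  split=> //; split=> [|g h Sg Sh|g Sg].
  - have := Zn; congr rank1_ge; apply/seteqP; split=> x; last by case.
    by move=> Zx; split; rewrite ?invg1 ?mul1g.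
  (* Both [gZ] meet [ghZ] and [Z] meet [gZ] are of full rank inside [gZ], so [Z], [gZ] and [ghZ]
     share a set of full rank. *)
  - have Sgh := rank1_ge_mull g^-1 (dRg h) Sh.
    have : rank1_ge rkG ([set x | stab_rel Z h (g^-1 * x)] `&` stab_rel Z g).
      apply: (irr_g g^-1) => //; first exact: definable_mull.
        by move=> x [].
      by move=> x [].
    apply: (rank1_ge_sub hrk) => //; first by apply: definableI => //; exact: definable_mull.
    by move=> x [[_ Zx] [Zy _]]; split; rewrite // invgM -mulgA.
  - have := rank1_ge_mull g (dRg g) Sg; congr rank1_ge.
    by apply/seteqP; split=> x /=; rewrite /stab_rel/= mulKg invgK => -[].
(* If the index were infinite, the translates of [Z] by representatives [u i] would pairwise meet in
   sets of smaller rank. Removing the earlier translates from each would leave infinitely many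
   disjoint sets of full rank. *)
have [[s _ sP]|[u [_ uP]]] := finite_cover_or_sequence setT (fun f g => S (f^-1 * g)).
  by exists s => g; exact: sP.
pose W i := [set x | Z ((u i)^-1 * x)].
have dW i : definable M (W i) by exact: definable_mull.
have dU i : definable M [set x | exists2 j, j \in iota 0 i & W j x].
  exact: definable_exists.
exfalso; apply: (not_rank1_ge_succ (definableT M)).
apply: (rank1_ge_succ hrk
    (F := fun i => W i `\` [set x | exists2 j, j \in iota 0 i & W j x])).
- exact: definableT.
- by move=> i; exact: definableD.
- by [].
- move=> i; have : rank1_ge rkG (W i) by exact: rank1_ge_mull.
  set U := mkset _.
  rewrite -[W i in X in X -> _](setUIDK (W i) U) => /(rank1_geU hrk).
  move=> /(_ (definableI (dW i) (dU i)) (definableD (dW i) (dU i)))[|//].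
  rewrite (_ : W i `&` U = [set x | exists2 j, j \in iota 0 i & (W i `&` W j) x]).
    case/(rank1_ge_exists hrk) => [j|j]; first exact: definableI.
    rewrite mem_iota add0n => /= /uP nS Wij; exfalso; apply: nS.
    have := rank1_ge_mull (u j) (definableI (dW i) (dW j)) Wij.
    congr rank1_ge; apply/seteqP; split=> x /=; rewrite /W/= mulKg.
      by rewrite /stab_rel invgM invgK -mulgA => -[].
    by rewrite /stab_rel invgM invgK -mulgA => -[].
  apply/seteqP; split=> x /=; first by case=> Wi [j ji Wj]; exists j.
  by case=> j ji [Wi Wj]; split=> //; exists j.
- move=> i j ij; rewrite -subset0 => x [[Wi _] [_]]; apply.
  by exists i; rewrite // mem_iota add0n.
Qed.

(* If [Z] is an irreducible part of [X], then [g Z] meets [Z] generically for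
   every [g], hence meets [Y] non-generically; but for each [x] in [Z], almost
   every [g] sends [x] into [Y]. *)
Lemma generic_meet X Y : definable M X -> definable M Y ->
  rank1_ge rkG X -> rank1_ge rkG Y -> X `&` Y !=set0.
Proof.
move=> dX dY Xn Yn; apply: contrapT => XY0.
have [Z [dZ ZX Zn irr]] := irreducible_exists dX Xn.
pose R g x := Z x /\ Y (g * x).
have dR : definable2 M R.
  exact: (definable2I (definable2_mem (Var G ord_max) dZ)
    (definable2_mem (Mul (Var G ord0) (Var G ord_max)) dY)).
have [[z Zz] _] := Zn; have [[y Yy] _] := Yn.
have D0 : dom R !=set0 by exists (y * z^-1), z; rewrite /R mulgVK.
have eZ : dom (fun x g => R g x) = Z.
  apply/seteqP; split=> [x [g []]//|x Zx].
  by exists (y * x^-1); rewrite /R mulgVK.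
(* Counted along [x] in [Z], each fibre is a right translate of [Y], hence of full rank. *)
have : rk2 rk (fun x g => R g x) = (rk1 Z + rkG)%N.
  rewrite -[in RHS]eZ; apply: (rk2_additive hrk (definable2_flip dR)).
    by rewrite eZ; exists z.
  move=> x [g [Zx _]]; rewrite -(rank1_ge_eq dY Yn) -(rk1_mulr x dY); last by exists y.
  by congr rk1; apply/seteqP; split=> h //= [].
rewrite (rk2_flip hrk dR D0) (rank1_ge_eq dZ Zn) => e.
(* Counted along [g], each section lies in [Z] and is disjoint from [stab_rel Z g^-1], which has
   full rank by [generic_stab]. *)
have lt g : dom R g -> (rk1 (R g) < rkG)%N.
  move=> [x Rgx]; rewrite ltnNge; apply/negP => le.
  apply: (irr (stab_rel Z g^-1) (R g)).
  - exact/definable2_section/definable2_stab_rel.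
  - exact/definable2_section.
  - by move=> ? [].
  - by move=> ? [].
  - rewrite -subset0 => v [[_ Zv] [_ Yv]]; apply: XY0; exists (g * v).
    by move: Zv; rewrite invgK => /ZX.
  - exact: generic_stab.
  - by split=> //; exists x.
(* Positivity makes the predecessor of [rkG] a genuine strict bound for the ranks of the
   sections. *)
have n0 : (0 < rkG)%N by case: D0 => g /lt; exact: leq_ltn_trans.
have := rk2_le hrk (b := rkG.-1) dR D0; rewrite e => /(_ _) le.
have : (rkG + rkG <= rk1 (dom R) + rkG.-1)%N.
  by apply: le => g /lt; rewrite -{1}(prednK n0) ltnS.
have dD : (rk1 (dom R) <= rkG)%N.
  by apply: (rk1_sub hrk) => //; [exact: definable_dom|exact: definableT].
by apply/negP; rewrite -ltnNge -addnS prednK// leq_add2r.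
Qed.

Lemma generic_setI X Y : definable M X -> definable M Y ->
  rank1_ge rkG X -> rank1_ge rkG Y -> rank1_ge rkG (X `&` Y).
Proof.
move=> dX dY Xn Yn; apply: contrapT => nXY.
have : rank1_ge rkG ((X `&` Y) `|` (X `\` Y)) by rewrite setUIDK.
case/(rank1_geU hrk) => //; [exact: definableI|exact: definableD|move=> XD].
have [x [[]]] := generic_meet (definableD dX dY) dY XD Yn.
by [].
Qed.

End Genericity.

(** * Coset covers and the lower central series *)

Section Cosets.
Variables (L : signature) (G : groupType) (M : structure L G).

(** Finitely many labels [i], attached through [c], are traded for finitely many elements of [Y], by
    picking one element for each label that occurs. *)
Lemma finite_representatives (I : eqType) (s : seq I) (Y : set G)
    (c : G -> I -> Prop) (E : G -> G -> Prop) :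
  (forall y, Y y -> exists2 i, i \in s & c y i) ->
  (forall y z i, Y y -> Y z -> c y i -> c z i -> E y z) ->
  exists2 l : seq G, (forall f, f \in l -> Y f) &
    forall y, Y y -> exists2 f, f \in l & E f y.
Proof.
move=> Ys cE; pose P i := exists y, Y y /\ c y i.
have /choice[r rP] i : exists y, P i -> Y y /\ c y i.
  by have [[y Py]|] := pselect (P i); [exists y|exists 1].
exists [seq r i | i <- s & `[<P i>]].
  move=> f /mapP[i]; rewrite mem_filter => /andP[/asboolP Pi _] ->.
  by have [] := rP i Pi.
move=> y Yy; have [i si cyi] := Ys y Yy; have Pi : P i by exists y.
have [Yr cr] := rP i Pi; exists (r i); last exact: cE cr cyi.
by apply/mapP; exists i => //; rewrite mem_filter si andbT; apply/asboolP.
Qed.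

Definition coset_cover (Y D : set G) : Prop :=
  exists s : seq G, forall y, Y y -> exists2 f, f \in s & D (f^-1 * y).

Lemma subgroup_div (D : set G) f y z : subgroup D ->
  D (f^-1 * y) -> D (f^-1 * z) -> D (y^-1 * z).
Proof.
move=> [_ DM DV] /DV Dy Dz; have := DM _ _ Dy Dz.
by rewrite invgM invgK -mulgA mulVKg.
Qed.

Lemma coset_cover_representatives Y D : subgroup D -> coset_cover Y D ->
  exists2 l : seq G, (forall f, f \in l -> Y f) &
    forall y, Y y -> exists2 f, f \in l & D (f^-1 * y).
Proof.
move=> sD [s sP].
apply: (finite_representatives (s := s) (c := fun y f => D (f^-1 * y))) => // y z f _ _.
exact: subgroup_div.
Qed.

(** An element of [Y] is labelled by a pair of cosets, one for the head of [l] and one for the rest;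
    elements with equal labels share a coset of the whole intersection. *)
Lemma coset_coverI Y (D : G -> set G) (l : seq G) :
  (forall i, i \in l -> subgroup (D i)) ->
  (forall i, i \in l -> coset_cover Y (D i)) ->
  coset_cover Y [set x | forall i, i \in l -> D i x].
Proof.
elim: l => [|i l IH] sD cD; first by exists [:: 1] => y _; exists 1; rewrite ?mem_head.
have [||s sP] := IH.
- by move=> j jl; apply: sD; rewrite inE jl orbT.
- by move=> j jl; apply: cD; rewrite inE jl orbT.
have [s' s'P] := cD i (mem_head _ _).
have [|y z [f g] _ _ /= [yf yg] [zf zg]|m _ mP] := finite_representatives
  (s := [seq (f, g) | f <- s, g <- s'])
  (Y := Y) (E := fun y z => forall j, j \in i :: l -> D j (y^-1 * z))
  (c := fun y fg => (forall j, j \in l -> D j (fg.1^-1 * y)) /\ D i (fg.2^-1 * y)).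
- move=> y Yy; have [f fs fP] := sP y Yy; have [g gs gP] := s'P y Yy.
  by exists (f, g) => //; apply/allpairsP; exists (f, g).
- move=> j jl; have sDj := sD j jl; move: jl; rewrite inE => /orP[/eqP ji|jl].
    by apply: (subgroup_div (f := g)) => //; rewrite ji.
  by apply: (subgroup_div (f := f)) => //; [exact: yf|exact: zf].
- by exists m.
Qed.

Lemma generated_subgroup (X : set G) : subgroup (generated X).
Proof.
split=> [K [[]]//|x y gx gy K sK|x gx K sK].
  by have [[_ KM _] _] := sK; apply: KM; [exact: gx|exact: gy].
by have [[_ _ KV] _] := sK; apply: KV; exact: gx.
Qed.

Lemma generated_sub (X K : set G) : subgroup K -> X `<=` K -> generated X `<=` K.
Proof. by move=> sK XK x; apply. Qed.

Lemma sub_generated (X : set G) : X `<=` generated X.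
Proof. by move=> x Xx K [_]; apply. Qed.

Lemma subgroup_conj (H : set G) g : subgroup H -> subgroup [set x | H (x ^ g)].
Proof.
move=> [H1 HM HV]; split=> [|x y|x] /=; rewrite ?conj1g ?conjMg ?conjVg//.
  exact: HM.
exact: HV.
Qed.

Section LowerCentral.
Variables (N : set G) (sN : subgroup N).

Lemma subgroupJ x y : N x -> N y -> N (x ^ y).
Proof.
move=> Nx Ny; have [_ NM NV] := sN; rewrite conjgE.
exact: NM (NV _ Ny) (NM _ _ Nx Ny).
Qed.

Lemma lower_central_subgroup k : subgroup (lower_central N k).
Proof. by case: k => //= k; exact: generated_subgroup. Qed.

Lemma lower_central_comm k x y : lower_central N k x -> N y ->
  lower_central N k.+1 [~ x, y].
Proof. by move=> xk Ny; apply: sub_generated; exists x, y. Qed.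

Lemma lower_centralS k : lower_central N k.+1 `<=` lower_central N k.
Proof.
elim: k => [|k IH]; apply: generated_sub.
- exact: lower_central_subgroup.
- move=> _ [x [y [Nx Ny ->]]]; have [_ NM NV] := sN.
  by apply: NM; [exact: NV|exact: subgroupJ].
- exact: lower_central_subgroup.
- by move=> _ [x [y [/IH xk Ny ->]]]; exact: lower_central_comm.
Qed.

Lemma lower_central_sub k : lower_central N k `<=` N.
Proof. by elim: k => // k IH x /lower_centralS /IH. Qed.

Lemma lower_centralJ k x y : lower_central N k x -> N y -> lower_central N k (x ^ y).
Proof.
move=> xk Ny; have [_ M' _] := lower_central_subgroup k.
have := M' _ _ xk (lower_centralS (lower_central_comm xk Ny)).
by rewrite commgEl mulVKg.
Qed.

End LowerCentral.

Variables (rk : rank_function G) (hrk : ranked M rk).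
Local Notation rk1 := (rk1 rk).

(** The descending chain condition: otherwise finite intersections give a strictly decreasing
    sequence [J] of definable subgroups, which the rank forbids. *)
Lemma definable_family_dcc (N : set G) (K : G -> set G) :
  (forall g, definable_subgroup M (K g)) ->
  exists2 l : seq G, (forall g, g \in l -> N g) &
    forall x, (forall g, g \in l -> K g x) -> forall g, N g -> K g x.
Proof.
move=> dK; apply: contrapT => ndcc.
pose I (l : seq G) := [set x | forall g, g \in l -> K g x].
have dI l : definable M (I l) by apply: definable_forall => g; have [] := dK g.
have sI l : subgroup (I l).
  split=> [g _|x y Ix Iy g gl|x Ix g gl]; have [[K1 KM KV] _] := dK g => //.
    by apply: KM; [exact: Ix|exact: Iy].
  by apply: KV; exact: Ix.
have /seq_dependent_choice[u uP] (l : seq G) : exists g, (forall h, h \in l -> N h) ->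
    N g /\ exists2 x, I l x & ~ K g x.
  have [lN|] := pselect (forall h, h \in l -> N h); last by exists 1.
  have /existsNP[x /not_implyP[Ix /existsNP[g /not_implyP[Ng Kgx]]]] :
      ~ forall x, I l x -> forall g, N g -> K g x.
    by move=> IK; apply: ndcc; exists l.
  by exists g => _; split=> //; exists x.
have mkS i : mkseq u i.+1 = rcons (mkseq u i) (u i).
  by rewrite /mkseq -addn1 iotaD map_cat /= add0n cats1.
have Nu i h : h \in mkseq u i -> N h.
  elim: i h => // i IH h; rewrite mkS mem_rcons inE => /orP[/eqP ->|/IH//].
  by have [] := uP i IH.
pose J i := I (mkseq u i).
have dJ i : definable M (J i) := dI _.
have JS i : exists2 x, J i x & ~ J i.+1 x.
  have [_ [x Ix Kx]] := uP i (Nu i); exists x => // JSx; apply: Kx; apply: JSx.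
  by rewrite mkS mem_rcons mem_head.
have Jmono i j : (i <= j)%N -> J j `<=` J i.
  move=> ij x Jx g /mapP[k]; rewrite mem_iota add0n => /= ki ->; apply: Jx.
  by apply/mapP; exists k => //; rewrite mem_iota add0n /= (leq_trans ki).
have J0 i : J i !=set0 by exists 1; have [] := sI (mkseq u i).
(* From an index [m] of minimal rank on, each difference of consecutive terms contains a coset of
   the smaller one, hence has rank at least [r]. These differences are disjoint, so [J m] would have
   rank above [r]. *)
have [r [m rm] rmin] : exists2 r, exists m, rk1 (J m) = r &
    forall i, (r <= rk1 (J i))%N.
  have ex : exists r, `[<exists m, rk1 (J m) = r>].
    by exists (rk1 (J 0%N)); apply/asboolP; exists 0%N.
  have [r /asboolP[m rm] rmin] := ex_minnP ex; exists r; first by exists m.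
  by move=> i; apply: rmin; apply/asboolP; exists i.
suff : rank1_ge rk r.+1 (J m) by case=> _; rewrite rm ltnn.
apply: (rank1_ge_succ hrk (F := fun i => J (m + i)%N `\` J (m + i).+1)) => //.
- by move=> i; exact: definableD.
- by move=> i x [Jx _]; apply: Jmono Jx; exact: leq_addr.
- move=> i; have [x Jx nJx] := JS (m + i)%N.
  have : rank1_ge rk r (J (m + i).+1) by [].
  move=> /(rank1_ge_mull hrk x^-1 (dJ _)).
  apply: (rank1_ge_sub hrk); [exact: definable_mull|exact: definableD|].
  move=> y /= Jxy; have [_ JM JV] := sI (mkseq u (m + i)%N); split.
    by rewrite -(mulVKg x y); apply: JM => //; apply: Jmono Jxy.
  move=> Jy; apply: nJx; have [_ JM' JV'] := sI (mkseq u (m + i).+1).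
  rewrite (_ : x = y * (x^-1 * y)^-1); last by rewrite invgM invgK mulVKg.
  exact: JM' _ _ Jy (JV' _ Jxy).
- move=> i j ij; rewrite -subset0 => x [[_ nJ] [Jx _]]; apply: nJ.
  by apply: Jmono Jx; rewrite -addnS leq_add2l.
Qed.

End Cosets.

(** * Connected nilpotent subgroups through a point of the coset *)

Section Nilpotent.
Variables (L : signature) (G : groupType) (M : structure L G).
Variables (rk : rank_function G) (hrk : ranked M rk).
Variables (H : set G) (dH : definable_subgroup M H) (x : G).
Hypothesis x_cover : coset_cover [set u | H (x^-1 * x ^ u)] H.

(** Label [z] by the coset of [D] containing [[~ x, z^-1]]. If [y] and [z] have the same label, the
    quotient of the two commutators, conjugated by [z], is [x^-1 * x ^ (y^-1 * z)]; it stays in [D],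
    and [x_cover] applies to [y^-1 * z]. The inverse in the label is what makes these left
    cosets. *)
Lemma lower_central_cover N D k : subgroup N -> N x -> subgroup D -> D `<=` H ->
  (forall g y, N g -> D y -> D (y ^ g)) ->
  coset_cover (lower_central N k.+1) D -> coset_cover (lower_central N k) H.
Proof.
move=> sN Nx sD DH nD [s sP].
have [z zk|y z i yk zk yi zi|l _ lP] := finite_representatives
  (s := s) (Y := lower_central N k) (c := fun z i => D (i^-1 * [~ x, z^-1]))
  (E := fun y z => H (x^-1 * x ^ (y^-1 * z))).
- have [_ _ V] := lower_central_subgroup sN k.
  have [_ _ VS] := lower_central_subgroup sN k.+1.
  (* The generating commutators have the element of the series first, so the inverse commutator is
     considered. *)
  apply: sP; rewrite -invgR; apply: VS; apply: lower_central_comm => //.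
  exact: V.
- apply: DH; have e : D ([~ x, z^-1]^-1 * [~ x, y^-1]) by apply: (subgroup_div (f := i)).
  have := nD z _ (lower_central_sub sN zk) e.
  rewrite !commgEl invgM invgK -mulgA mulVKg.
  by rewrite conjMg conjVg conjgKV -conjgM.
have [s' s'P] := x_cover.
exists [seq y * f | y <- l, f <- s'] => z zk; have [y yl Eyz] := lP z zk.
have [f fs Hf] := s'P _ Eyz; exists (y * f); first by apply/allpairsP; exists (y, f).
by rewrite invgM -mulgA.
Qed.

Lemma coset_coverJ N k g : subgroup N -> N g ->
  coset_cover (lower_central N k) H ->
  coset_cover (lower_central N k) [set y | H (y ^ g)].
Proof.
move=> sN Ng [s sP]; exists [seq f ^ g^-1 | f <- s] => y yk.
have [f fs Hf] := sP _ (lower_centralJ sN yk Ng); exists (f ^ g^-1); first exact: map_f.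
by rewrite /= conjMg conjVg conjgKV.
Qed.

Lemma connected_nilpotent_mem N : connected_subgroup M N -> nilpotent N -> N x -> H x.
Proof.
move=> [sN [K [[[sK dK] NK Kmin] [_ [_ _ Kconn]]]]] [c Nc] Nx.
have [sH dfH] := dH.
pose P k := exists D, [/\ definable_subgroup M D, D `<=` H,
  forall g y, N g -> D y -> D (y ^ g) & coset_cover (lower_central N k) D].
have P0 : P 0%N.
  (* The series is climbed from its trivial term [c], where [D] is trivial, up to [N] itself. *)
  suff Pk k : P (c - k)%N by rewrite -(subnn c).
  elim: k => [|k [D [[sD dD] DH nD cD]]].
    rewrite subn0; exists [set 1]; split.
    - split; last exact: definable_set1.
      by split=> // [_ _ -> ->|_ ->] /=; rewrite ?mulg1 ?invg1.
    - by move=> _ ->; have [] := sH.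
    - by move=> g _ _ ->; rewrite conj1g.
    - by rewrite Nc; exists [:: 1] => _ ->; exists 1; rewrite ?mem_head//= mulVg.
  (* When [c <= k], truncated subtraction gives 0 on both sides and [D] is kept. *)
  have [ck|kc] := leqP c k.
    exists D; split=> //; move: cD.
    by rewrite (eqP ck) (eqP (leqW ck)).
  move: cD; rewrite subnS; case: (c - k)%N (subn_gt0 k c) => [|j _ cD /=].
    by rewrite kc.
  have cH := lower_central_cover sN Nx sD DH nD cD.
  pose F g := [set y | H (y ^ g)].
  have sF g : subgroup (F g) by exact: subgroup_conj.
  have dF g : definable_subgroup M (F g) by split=> //; exact: definable_conj.
  have [l lN lP] := definable_family_dcc hrk N dF.
  (* The chain condition makes this finite intersection equal to that of all conjugates of [H] under
     [N]. Hence it is definable, normalized by [N], and contained in [H] through the conjugate by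
     1. *)
  pose I := [set y | forall g, g \in l -> F g y].
  have sI : subgroup I.
    split=> [g _|y z Iy Iz g gl|y Iy g gl]; have [F1 FM FV] := sF g => //.
      by apply: FM; [exact: Iy|exact: Iz].
    by apply: FV; exact: Iy.
  exists I; split.
  - by split=> //; apply: definable_forall => g; have [] := dF g.
  - move=> y /lP /(_ 1); rewrite /F /= conjg1; apply.
    by have [] := sN.
  - move=> g y Ng /lP Iy h hl; rewrite /F /= -conjgM; apply: Iy.
    by have [_ NM _] := sN; apply: NM => //; exact: lN.
  - by apply: coset_coverI => // g gl; apply: coset_coverJ => //; exact: lN.
have [D [[sD dD] DH nD cD]] := P0.
have [l lN lP] := coset_cover_representatives sD cD.
have [N1 NM NV] := sN; have [D1 DM DV] := sD.
(* The product of [N] and [D], written with finitely many representatives so as to be definable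
   although [N] need not be. *)
pose ND := [set y | exists2 f, f \in l & D (f^-1 * y)].
have NDE y : ND y <-> exists2 n, N n & D (n^-1 * y).
  split=> [[f fl Df]|[n Nn Dn]]; first by exists f; rewrite //; exact: lN.
  have [f fl Df] := lP _ Nn; exists f => //.
  by rewrite -(mulgK n f^-1) -mulgA; exact: DM.
have sND : subgroup ND.
  split=> [|y z /NDE[n Nn Dn] /NDE[m Nm Dm]|y /NDE[n Nn Dn]]; apply/NDE.
  - by exists 1; rewrite // invg1 mul1g.
  - exists (n * m); first exact: NM.
    rewrite (_ : _ * _ = (n^-1 * y) ^ m * (m^-1 * z)).
      by apply: DM => //; exact: nD.
    by rewrite conjgE invgM -!mulgA mulVKg.
  - exists n^-1; first exact: NV.
    rewrite (_ : _ * _ = ((n^-1 * y)^-1) ^ n^-1).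
      by apply: nD; [exact: NV|exact: DV].
    by rewrite conjgE !invgM !invgK -!mulgA mulgV mulg1.
have dND : definable M ND.
  by apply: definable_exists => f; exact: definable_mull.
have KND : K `<=` ND.
  by apply: Kmin => // n Nn; apply/NDE; exists n; rewrite ?mulVg.
(* The hull [K] of [N] lies in [ND], so [D] cuts it in a subgroup of finite index; as [K] is
   connected, it lies in [D]. *)
apply: DH; have /(_ _ (NK _ Nx))[] // : K `<=` K `&` D.
have [K1 KM KV] := sK.
apply: Kconn.
  split; last exact: definableI.
  split=> // [y z [Ky Dy] [Kz Dz]|y [Ky Dy]].
    by split; [exact: KM|exact: DM].
  by split; [exact: KV|exact: DV].
split; first by move=> y [].
apply: (@sub_finite_set _ _ [set left_coset f (K `&` D) | f in [set` l]]);
  last exact/finite_image/finite_seq.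
move=> _ [y Ky <-]; have [f fl Df] := KND _ Ky; exists f => //.
have Kf : K f by exact/NK/lN.
have e1 : (K `&` D) (f^-1 * y) by split=> //; apply: KM => //; exact: KV.
have e2 : (K `&` D) (y^-1 * f).
  by rewrite -[f]invgK -invgM; case: e1 => a b; split; [exact: KV|exact: DV].
apply/seteqP; split=> _ [z [Kz Dz] <-].
  exists (y^-1 * f * z); last by rewrite -mulgA mulVKg.
  by case: e2 => a b; split; [exact: KM|exact: DM].
exists (f^-1 * y * z); last by rewrite -mulgA mulVKg.
by case: e1 => a b; split; [exact: KM|exact: DM].
Qed.

End Nilpotent.

(** * Generous cosets *)

Section Generous.
Variables (L : signature) (G : groupType) (M : structure L G).
Variables (rk : rank_function G) (hrk : ranked M rk).
Local Notation rk1 := (rk1 rk).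
Local Notation rank1_ge := (rank1_ge rk).
Local Notation rkG := (rk1 [set: G]).

Lemma genericE X : definable M X -> generic rk [set: G] X <-> rank1_ge rkG X.
Proof.
move=> dX; rewrite /generic !rk_points; split=> [[_ X0 e]|Xn]; first by split; rewrite ?e.
by split=> //; [case: Xn|exact: (rank1_ge_eq hrk)].
Qed.

Variables (H : set G) (dH : definable_subgroup M H) (w : G).
Hypothesis hw : normalizer H w.

Definition conj_rel (g x : G) := H (w^-1 * x ^ g^-1).

Lemma definable2_conj_rel : definable2 M conj_rel.
Proof.
exact: (definable2_mem (Mul (Param 2 w^-1)
  (Mul (Defs.Inv (Defs.Inv (Var G ord0)))
       (Mul (Var G ord_max) (Defs.Inv (Var G ord0))))) dH.2).
Qed.

Lemma conj_relE g x : conj_rel g x <-> conj_set (left_coset w H) g x.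
Proof.
split=> [Rgx|[_ [h Hh <-] <-]]; last by rewrite /conj_rel conjgK mulKg.
by exists (x ^ g^-1); [exists (w^-1 * x ^ g^-1); rewrite ?mulVKg|rewrite conjgKV].
Qed.

Lemma dom_conj_rel : dom conj_rel = [set: G].
Proof.
apply/seteqP; split=> // g _; exists (w ^ g).
by rewrite /conj_rel conjgK mulVg; have [[]] := dH.
Qed.

Lemma rk1_conj_rel g : rk1 (conj_rel g) = rk1 H.
Proof.
have [[H1 _ _] dfH] := dH; apply/esym.
apply: (rk1_inj hrk (t := Mul (Param 1 g^-1)
  (Mul (Mul (Param 1 w) (Var G ord0)) (Param 1 g)))) => //.
- exact/definable2_section/definable2_conj_rel.
- by exists 1.
- by move=> h Hh /=; rewrite tnth0 /conj_rel -conjgE conjgK mulKg.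
- by move=> h k _ _ /=; rewrite !tnth0 => /mulgI/mulIg/mulgI.
- move=> y Rgy; exists (w^-1 * y ^ g^-1) => //=.
  by rewrite tnth0 mulVKg -conjgE conjgKV.
Qed.

(** Since [w] normalizes [H], conjugation by elements of [H] preserves the coset [wH]. *)
Lemma conj_rel_mull h g x : H h -> conj_rel g x -> conj_rel (h * g) x.
Proof.
have [[_ HM HV] _] := dH => Hh; rewrite /conj_rel invgM conjgM => Rgx.
rewrite (_ : _ * _ = (h ^ w) * (w^-1 * x ^ g^-1) * h^-1).
  apply: (HM); last exact: HV.
  by apply: HM => //; rewrite -{1}hw; exists h.
by rewrite !conjgE invgK !mulgA mulgK.
Qed.

(* The pairs [(g, x)] with [x] in [(wH)^g] form a set of rank [rk G + rk H], so
   over a generic [x] the [g]'s form a set of rank at most [rk H]; this set is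
   a union of cosets [Hg]. *)
Lemma generous_cover : generous rk (left_coset w H) ->
  exists T, [/\ definable M T, rank1_ge rkG T &
    forall x, T x -> exists g, conj_rel g x /\
      exists s : seq G, forall f, conj_rel f x -> exists2 y, y \in s & H (f * y^-1)].
Proof.
have dR := definable2_conj_rel; have dRf := definable2_flip dR.
have eD : dom (fun x g => conj_rel g x) =
    \bigcup_(g in [set: G]) conj_set (left_coset w H) g.
  by apply/seteqP; split=> x [g] => [/conj_relE|_ /conj_relE]; exists g.
rewrite /generous -eD => /(genericE (definable_dom dRf)) Dn.
have rD := rank1_ge_eq hrk (definable_dom dRf) Dn.
have D0 : dom conj_rel !=set0 by rewrite dom_conj_rel; exists 1.
(* The number [k] is the rank of the set of conjugators [g] over each point of [T]; comparing the
   two counts of pairs yields [k <= rk1 H]. *)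
have [k [T [dT TD Tn Tk]]] := generic_section hrk dRf Dn.1.
rewrite (rk2_flip hrk dR D0) (rk2_additive hrk (k := rk1 H) dR D0); last first.
  by move=> g _; exact: rk1_conj_rel.
rewrite dom_conj_rel rD leq_add2l => kH; rewrite rD in Tn.
exists T; split=> // x Tx; have [g Rgx] := TD _ Tx; exists g; split=> //.
(* Infinitely many cosets of [H] in the set of conjugators would give it rank above that of [H]. *)
have [[s _ sP]|[u [Ru uH]]] := finite_cover_or_sequence
  [set f | conj_rel f x] (fun y f => H (f * y^-1)); first by exists s.
have [[H1 HM HV] dfH] := dH.
have dRx := definable2_section x dRf.
have [_] : rank1_ge (rk1 H).+1 [set f | conj_rel f x].
  apply: (rank1_ge_succ hrk (F := fun i => [set y | H (y * (u i)^-1)])) => //.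
  - by move=> i; exact: (definable_preimage (Mul (Var G ord0) (Param 1 (u i)^-1))).
  - move=> i y /= Hy; rewrite -[y](mulgVK (u i)); exact: (conj_rel_mull Hy (Ru i)).
  - by move=> i; apply: (rank1_ge_mulr hrk) => //; split=> //; exists 1.
  - move=> i j ij; rewrite -subset0 => y [/= Hi Hj]; apply: (uH _ _ ij).
    by have := HM _ _ (HV _ Hj) Hi; rewrite invgM invgK -mulgA mulKg.
by rewrite (Tk x Tx) ltnNge kH.
Qed.

(** Rather than moving [x] into [wH], the argument replaces [H] by its conjugate under [g].
    Membership of [x] in that conjugate would put [w] in [H]. *)
Lemma generous_nilpotent : ~ H w -> generous rk (left_coset w H) ->
  exists T, [/\ definable M T, rank1_ge rkG T &
    forall x, T x -> ~ in_connected_nilpotent M x].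
Proof.
move=> nHw /generous_cover[T [dT Tn TP]]; exists T; split=> // x Tx [N [cN nN Nx]].
have [g [Rgx [s sP]]] := TP x Tx; apply: nHw.
have [sH dfH] := dH; have [_ HM HV] := sH.
have dHg : definable_subgroup M [set y | H (y ^ g^-1)].
  by split; [exact: subgroup_conj|exact: definable_conj].
suff /(connected_nilpotent_mem hrk dHg)/(_ _ cN nN Nx)/= Hx :
    coset_cover [set u | H ((x^-1 * x ^ u) ^ g^-1)] [set y | H (y ^ g^-1)].
  by have := HM _ _ Hx (HV _ Rgx); rewrite invgM invgK mulVKg.
(* Such a [u] makes [g * u^-1] a conjugator for [x], hence an element of some [Hy]; inverting turns
   this into a left coset, represented by [y^-1 * g], of the conjugate of [H]. *)
exists [seq y^-1 * g | y <- s] => u /= Hu.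
have : conj_rel (g * u^-1) x.
  rewrite /conj_rel invgM invgK conjgM -(mulVKg (x ^ g^-1) (_ ^ g^-1)) mulgA.
  by apply: HM => //; move: Hu; rewrite conjMg conjVg.
case/sP=> y ys Hy; exists (y^-1 * g); first exact: map_f.
have := HV _ Hy; rewrite conjgE !invgM !invgK !mulgA.
by rewrite mulgV mul1g.
Qed.

End Generous.

(** * The generic type *)

Section Saturation.
Variables (L : signature) (G : groupType) (M : structure L G).

Fixpoint term_params n (t : term G n) : seq G :=
  match t with
  | Param g => [:: g]
  | Defs.Inv t1 => term_params t1
  | Mul t1 t2 => term_params t1 ++ term_params t2
  | _ => [::]
  end.

Fixpoint formula_params n (phi : formula L G n) : seq G :=
  match phi with
  | Eq _ t1 t2 => term_params t1 ++ term_params t2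
  | Rel _ _ ts => flatten [seq term_params t | t <- ts]
  | Not _ phi1 => formula_params phi1
  | And _ phi1 phi2 => formula_params phi1 ++ formula_params phi2
  | Ex _ phi1 => formula_params phi1
  end.

Lemma term_over_params n (t : term G n) (A : set G) :
  (forall g, g \in term_params t -> A g) -> term_over A t.
Proof.
elim: t => //= [g|t1 IH1 t2 IH2] tA; first by apply: tA; rewrite mem_head.
by split; [apply: IH1|apply: IH2] => g gt; apply: tA; rewrite mem_cat gt ?orbT.
Qed.

Lemma formula_over_params n (phi : formula L G n) (A : set G) :
  (forall g, g \in formula_params phi -> A g) -> formula_over A phi.
Proof.
elim: phi => //= {n} [n t1 t2|n r ts|n phi1 IH1 phi2 IH2] tA.
- by split; apply: term_over_params => g gt; apply: tA; rewrite mem_cat gt ?orbT.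
- move=> i; apply: term_over_params => g gt; apply: tA.
  apply/flattenP; exists (term_params (tnth ts i)) => //.
  by rewrite -tnth_map; exact: mem_tnth.
- by split; [apply: IH1|apply: IH2] => g gt; apply: tA; rewrite mem_cat gt ?orbT.
Qed.

Lemma term_over_sub n (t : term G n) (A B : set G) :
  A `<=` B -> term_over A t -> term_over B t.
Proof.
by move=> AB; elim: t => //= t1 IH1 t2 IH2 [/IH1 ? /IH2 ?].
Qed.

Lemma formula_over_sub n (phi : formula L G n) (A B : set G) :
  A `<=` B -> formula_over A phi -> formula_over B phi.
Proof.
move=> AB; elim: phi => //= {n} [n t1 t2 []|n r ts tA i|n phi1 IH1 phi2 IH2 []].
- by move=> /(term_over_sub AB) ? /(term_over_sub AB).
- exact: term_over_sub (tA i).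
- by move=> /IH1 ? /IH2.
Qed.

(* Shift along an injection of [nat] into [A], starting at [b]. *)
Lemma infinite_card_setU1 T (A : set T) b : infinite_set A -> A `|` [set b] #<= A.
Proof.
elim/Ppointed: T => T in A b *; first by rewrite !emptyE.
move=> /infiniteP/ppcard_leP[u].
have uA n : A (u n) by exact: 'funS_u.
have u_inj : injective u by move=> i j; apply: 'inj_u; rewrite inE.
have [Ab|nAb] := pselect (A b).
  by apply: subset_card_le => x [|->].
pose E x y := [\/ x = b /\ y = u 0%N, exists n, x = u n /\ y = u n.+1
  | [/\ x <> b, forall n, x <> u n & y = x]].
have /choice[f fP] x : exists y, E x y.
  have [xb|xb] := pselect (x = b); first by exists (u 0%N); constructor 1.
  have [[n xn]|nx] := pselect (exists n, x = u n).
    by exists (u n.+1); constructor 2; exists n.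
  by exists x; constructor 3; split=> // n xn; apply: nx; exists n.
apply/pcard_leP/injfunPex; exists f.
  move=> x Abx; case: (fP x) => [[_ ->]//|[n [_ ->]]//|[xb _ ->]].
  by case: Abx.
move=> x y _ _ e; case: (fP x) (fP y) => [[xb fx]|[n [xn fx]]|[xb xu fx]]
    [[yb fy]|[m [ym fy]]|[yb yu fy]]; move: e; rewrite fx fy.
- by rewrite xb yb.
- by move=> /u_inj.
- by move=> /esym/yu.
- by move=> /u_inj.
- by move=> /u_inj [nm]; rewrite xn ym nm.
- by move=> /esym/yu.
- by move=> /xu.
- by move=> /xu.
- by [].
Qed.

(** Elements are added one at a time: a finite set remains finite, and an infinite one keeps its
    cardinality. *)
Lemma small_setU (A : set G) (s : seq G) : infinite_set [set: G] ->
  small A -> small (A `|` [set` s]).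
Proof.
move=> Ginf; elim: s A => [|b s IH] A sA.
  by rewrite set_nil setU0.
rewrite (_ : _ `|` _ = (A `|` [set b]) `|` [set` s]).
  apply: IH; split; first exact: card_leT.
  move=> Gle; have [fA|iA] := pselect (finite_set A).
    apply: Ginf; apply: card_le_finite Gle _.
    by rewrite finite_setU; split=> //; exact: finite_set1.
  by apply: sA.2; apply: card_le_trans Gle _; exact: infinite_card_setU1.
rewrite -setUA; congr (A `|` _); apply/seteqP; split=> g /=.
  by rewrite inE => /orP[/eqP ->|gs]; [left|right].
by case=> [->|gs]; rewrite inE ?eqxx// gs orbT.
Qed.

Variables (rk : rank_function G) (hrk : ranked M rk).
Hypothesis hconn : connected_definable M [set: G].

(** In a finite group the trivial subgroup has finite index, so connectedness would make the group
    trivial. *)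
Lemma connected_infinite (g : G) : g <> 1 -> infinite_set [set: G].
Proof.
move=> g1 fG; apply: g1; have [_ [_ _ min]] := hconn.
apply: (min [set 1]) => //; last by split=> //; exact: finite_image.
split; last exact: definable_set1.
by split=> // [_ _ -> ->|_ ->] /=; rewrite ?mulg1 ?invg1.
Qed.

Lemma definable_solutions (phi : formula L G 1) : definable M (solutions M phi).
Proof. by exists phi. Qed.

Local Notation rkG := (rk1 rk [set: G]).

Lemma rank1_geT : rank1_ge rk rkG [set: G].
Proof. by split=> //; exists 1. Qed.

Lemma generic_typeE A phi : generic_type M rk A phi <->
  formula_over A phi /\ rank1_ge rk rkG (solutions M phi).
Proof.
by split=> -[Aphi /(genericE hrk (definable_solutions phi)) g]; split.
Qed.

Lemma complete_generic_type A : complete_type M A (generic_type M rk A).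
Proof.
split=> [phi []//|q fq qp|phi Aphi].
  (* Finite satisfiability is strengthened to a generic set of realizations, obtained by
     intersecting generic sets one at a time. *)
  suff [D [_ [[x Dx] _] Dq]] : exists D, [/\ definable M D, rank1_ge rk rkG D &
      forall x, D x -> realizes M q [tuple x]] by exists [tuple x]; exact: Dq.
  have [n qn] := fq; have /pfcard_geP[->|] : q #<= `I_n by have /card_eqPle[] := qn.
    by exists setT; split=> [||x _ phi//]; [exact: definableT|exact: rank1_geT].
  move=> [f].
  pose D m := [set x | forall i, (i < m)%N -> sat M (f i) [tuple x]].
  have [] // : definable M (D n) /\ rank1_ge rk rkG (D n).
    have : (n <= n)%N by [].
    elim: {-2}n => [_|m IH mn].
      rewrite (_ : D 0%N = setT); last exact/seteqP.
      by split; [exact: definableT|exact: rank1_geT].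
    have [dD Dm] := IH (ltnW mn).
    have /qp/generic_typeE[_ fm] : q (f m) by exact: 'funS_f.
    rewrite (_ : D m.+1 = D m `&` solutions M (f m)).
      split; first exact/definableI/definable_solutions.
      exact: (generic_setI hrk hconn dD (definable_solutions _) Dm fm).
    apply/seteqP; split=> x /=.
      by move=> Dx; split=> [i im|]; apply: Dx => //; exact: ltnW.
    by case=> Dx fx i; rewrite ltnS leq_eqVlt => /orP[/eqP->|/Dx].
  move=> dD Dn; exists (D n); split=> // x Dx phi /'surj_f[i In <-].
  exact: Dx.
have [phiN|nphi] := pselect (rank1_ge rk rkG (solutions M phi)).
  by left; apply/generic_typeE.
right; apply/generic_typeE; split=> //.
have : rank1_ge rk rkG (solutions M phi `|` ~` solutions M phi).
  by rewrite setUv; exact: rank1_geT.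
by case/(rank1_geU hrk (definable_solutions phi) (definableC (definable_solutions phi))).
Qed.

Lemma generic_nilpotent_meet T : infinite_set [set: G] ->
  generically_connected_nilpotent M rk -> definable M T -> rank1_ge rk rkG T ->
  exists2 x, T x & in_connected_nilpotent M x.
Proof.
move=> Ginf [[satM [A [sA AN]]]|[X [dX /(genericE hrk dX) Xn XN]]] dT Tn; last first.
  by have [x [Tx /XN]] := generic_meet hrk hconn dT dX Tn Xn; exists x.
(* Adding the parameters of a formula for [T] puts that formula into the generic type over [B], and
   a realization of this type also realizes the one over [A]. *)
have [phi ephi] := dT; pose B := A `|` [set` formula_params phi].
have [v vP] := satM B 1%N _ (small_setU (formula_params phi) Ginf sA)
  (complete_generic_type B).
have ev := tuple1E v; rewrite ev in vP.
exists (thead v).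
  rewrite ephi; apply: vP; apply/generic_typeE; split; last by rewrite -ephi.
  by apply: formula_over_params => g gphi; right.
apply: AN => psi [Apsi gpsi]; apply: vP; split=> //.
by apply: formula_over_sub Apsi => g Ag; left.
Qed.

End Saturation.

Theorem theorem1 (L : signature) (G : groupType) (M : structure L G)
    (rk : rank_function G) (hrk : ranked M rk)
    (hconn : connected_definable M [set: G])
    (hgen : generically_connected_nilpotent M rk)
    (H : set G) (hH : definable_subgroup M H)
    (w : G) (hw : normalizer H w) (hwH : ~ H w) :
  ~ generous rk (left_coset w H).
Proof.
move=> /(generous_nilpotent hrk hH hw hwH)[T [dT Tn TN]].
(* A nontrivial element makes [G] infinite, which keeps sets of parameters small when finitely many
   elements are added. *)
have w1 : w <> 1%g by move=> e; apply: hwH; rewrite e; have [[]] := hH.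
have [x /TN] := generic_nilpotent_meet hrk hconn (connected_infinite hconn w1) hgen dT Tn.
by [].
Qed.
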